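(* There is an absolute constant $C>0$ such that for every metric space $(X,d)$ with $n=|X|\ge 2$ points, there exists a $12$-geometric marked DAG $\hat{\mathcal D}=(\mathcal D,\omega,\theta)$ over $X$ that is $1$-expanding and $(C\log n)$-Lipschitz with respect to $(X,d)$, and which satisfies $\Delta_0(\mathcal D)+\Delta_I(\hat{\mathcal D})\le C\log n$.
   Context: Let $X$ be a finite set. A DAG over $X$ is a finite directed acyclic graph $\mathcal D=(V,A)$ with $X\subseteq V$, having a single source $r\in V$, and whose set of sinks is exactly $X$. Write $uv$ for an arc $(u,v)\in A$. A flow is a vector $F\in\mathbb R_+^A$ with $\sum_{v:uv\in A}F_{uv}=\sum_{v:vu\in A}F_{vu}$ for every $u\in V\setminus(X\cup\{r\})$; put $F_u:=\sum_{v:uv\in A}F_{uv}$ for $u\in V\setminus X$ and $F_x:=\sum_{u:ux\in A}F_{ux}$ for $x\in X$. A unit flow is a flow with $F_r=1$. $\mathcal P_{\mathcal D}$ denotes the set of directed paths from $r$ to a sink, and $\bar\gamma$ denotes the final vertex of a path $\gamma$. A marked DAG is a triple $\hat{\mathcal D}=(\mathcal D,\omega,\theta)$ where $\omega\in\mathbb R_{>0}^A$ satisfies $\omega_{uv}>\omega_{vw}$ whenever $uv,vw\in A$, and $\theta\in\mathbb R_{>0}^A$ satisfies $\sum_{v:uv\in A}\theta_{uv}=1$ for every $u\in V\setminus X$. For $\gamma\in\mathcal P_{\mathcal D}$ put $\theta(\gamma):=\prod_{uv\in\gamma}\theta_{uv}$. The combinatorial depth $\Delta_0(\mathcal D)$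 is the maximum number of arcs of a path in $\mathcal P_{\mathcal D}$; the information depth is $\Delta_I(\hat{\mathcal D}):=\max_{\gamma\in\mathcal P_{\mathcal D}}\log(1/\theta(\gamma))$. $\hat{\mathcal D}$ is $\tau$-geometric if $\omega_{uv}\ge\tau\,\omega_{vw}$ whenever $uv,vw\in A$. For $\gamma_1\neq\gamma_2\in\mathcal P_{\mathcal D}$ let $u$ be the first vertex at which they diverge, i.e. $uv_1\in\gamma_1$, $uv_2\in\gamma_2$, $v_1\ne v_2$, and set $\mathrm{dist}_{\hat{\mathcal D}}(\gamma_1,\gamma_2):=\max(\omega_{uv_1},\omega_{uv_2})$, with $\mathrm{dist}_{\hat{\mathcal D}}(\gamma,\gamma)=0$. For unit flows $F,F'$, $\mathbb W^1_{\hat{\mathcal D}}(F,F')$ is the $L^1$ transportation cost with respect to $\mathrm{dist}_{\hat{\mathcal D}}$ between $F$ and $F'$ viewed as probability distributions on $\mathcal P_{\mathcal D}$ (i.e. the infimum, over probability measures $\mu,\mu'$ on $\mathcal P_{\mathcal D}$ with $\sum_\gamma\mu(\gamma)\mathbb 1_\gamma=F$ and $\sum_\gamma\mu'(\gamma)\mathbb 1_\gamma=F'$, of the optimal transport cost between $\mu$ and $\mu'$). Given a metric $d$ on $X$: $\hat{\mathcal D}$ is $\epsilon$-expanding if $\mathrm{dist}_{\hat{\mathcal D}}(\gamma_1,\gamma_2)\ge\epsilon\, d(\bar\gamma_1,\bar\gamma_2)$ for all $\gamma_1,\gamma_2\in\mathcal P_{\mathcal D}$; $\hat{\mathcal D}$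 is $L$-Lipschitz if for every $m\ge1$ and every sequence $x_1,\dots,x_m\in X$ there are unit flows $F^{(1)},\dots,F^{(m)}$ with $F^{(i)}$ a unit flow to $x_i$ (i.e. $F^{(i)}_y=0$ for every sink $y\ne x_i$) and $\sum_{i=1}^{m-1}\mathbb W^1_{\hat{\mathcal D}}(F^{(i)},F^{(i+1)})\le L\sum_{i=1}^{m-1}d(x_i,x_{i+1})$. *)

(* Defs.v *)
From HB Require Import structures.
From Stdlib Require Import Rdefinitions Rpower.
From mathcomp Require Import all_boot all_order all_algebra.
From mathcomp Require Import boolp classical_sets fsbigop reals Rstruct.
Set Implicit Arguments. Unset Strict Implicit. Unset Printing Implicit Defensive.
Import Order.TTheory GRing.Theory Num.Theory.
Local Open Scope classical_set_scope.
Local Open Scope ring_scope.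

Definition is_metric (X : finType) (d : X -> X -> R) : Prop :=
  (forall x y : X, d x y = 0 <-> x = y) /\
  (forall x y : X, d x y = d y x) /\
  (forall x y z : X, d x z <= d x y + d y z).

Section MarkedDAG.
(* The vertex set is V = X + W: the points of X are the vertices [inl x],
   W indexes the remaining vertices. [A] is the arc relation, [r] the source. *)
Variables (X W : finType).
Local Notation V := (X + W)%type.
Variables (A : rel V) (r : V).

Definition is_sink (v : V) : bool := [forall w, ~~ A v w].
Definition is_src (v : V) : bool := [forall u, ~~ A u v].

Definition is_dag : Prop :=
  (forall (v : V) (p : seq V), path A v p -> p != [::] -> last v p != v) /\
  (forall v : V, is_src v <-> v = r) /\
  (forall v : V, is_sink v <-> exists x : X, v = inl x).

Definition rpath (g : seq V) : Prop :=
  exists p : seq V, g = r :: p /\ path A r p /\ is_sink (last r p).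

Definition Paths : set (seq V) := [set g | rpath g].

Definition arcs (g : seq V) : seq (V * V) := zip g (behead g).

Definition nb_arcs (g : seq V) : nat := (size g).-1.

Variables (omega theta : V -> V -> R).

Definition is_marked : Prop :=
  is_dag /\
  (forall u v : V, A u v -> 0 < omega u v) /\
  (forall u v w : V, A u v -> A v w -> omega u v > omega v w) /\
  (forall u v : V, A u v -> 0 < theta u v) /\
  (forall u : V, (forall x : X, u <> inl x) -> \sum_(v | A u v) theta u v = 1).

Definition theta_path (g : seq V) : R := \prod_(e <- arcs g) theta e.1 e.2.

(* combinatorial depth and information depth (maxima over the finite,
   nonempty set of paths) *)
Definition depth0 : R := sup [set (nb_arcs g)%:R | g in Paths].
Definition depthI : R := sup [set ln (1 / theta_path g) | g in Paths].

Definition geometric (tau : R) : Prop :=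
  forall u v w : V, A u v -> A v w -> omega u v >= tau * omega v w.

Fixpoint lcp (g1 g2 : seq V) : nat :=
  match g1, g2 with
  | a :: g1', b :: g2' => if a == b then (lcp g1' g2').+1 else 0%N
  | _, _ => 0%N
  end.

(* dist(g1, g2): u = the vertex at which they diverge (the last common
   vertex, at index lcp - 1), v_i the next vertices. *)
Definition pdist (g1 g2 : seq V) : R :=
  if g1 == g2 then 0 else
  let k := lcp g1 g2 in
  Num.max (omega (nth r g1 k.-1) (nth r g1 k))
          (omega (nth r g2 k.-1) (nth r g2 k)).

Definition outflow (F : V -> V -> R) (u : V) : R := \sum_(v | A u v) F u v.
Definition inflow (F : V -> V -> R) (x : V) : R := \sum_(u | A u x) F u x.

Definition is_flow (F : V -> V -> R) : Prop :=
  (forall u v : V, A u v -> 0 <= F u v) /\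
  (forall u : V, (forall x : X, u <> inl x) -> u <> r ->
     outflow F u = inflow F u).

Definition unit_flow (F : V -> V -> R) : Prop := is_flow F /\ outflow F r = 1.

Definition unit_flow_to (F : V -> V -> R) (x : X) : Prop :=
  unit_flow F /\ (forall y : X, y <> x -> inflow F (inl y) = 0).

Definition prob_on_paths (mu : seq V -> R) : Prop :=
  (forall g, Paths g -> 0 <= mu g) /\ \sum_(g \in Paths) mu g = 1.

Definition represents (mu : seq V -> R) (F : V -> V -> R) : Prop :=
  prob_on_paths mu /\
  (forall u v : V, A u v ->
     \sum_(g \in Paths) mu g * ((u, v) \in arcs g)%:R = F u v).

Definition coupling (pi : seq V -> seq V -> R) (mu mu' : seq V -> R) : Prop :=
  (forall g g', Paths g -> Paths g' -> 0 <= pi g g') /\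
  (forall g, Paths g -> \sum_(g' \in Paths) pi g g' = mu g) /\
  (forall g', Paths g' -> \sum_(g \in Paths) pi g g' = mu' g').

Definition transport_cost (pi : seq V -> seq V -> R) : R :=
  \sum_(g \in Paths) \sum_(g' \in Paths) pi g g' * pdist g g'.

Definition OT (mu mu' : seq V -> R) : R :=
  inf [set c | exists pi, coupling pi mu mu' /\ c = transport_cost pi].

Definition W1 (F F' : V -> V -> R) : R :=
  inf [set c | exists mu mu', represents mu F /\ represents mu' F' /\
                 c = OT mu mu'].

Definition expanding (d : X -> X -> R) (eps : R) : Prop :=
  forall (g1 g2 : seq V) (x1 x2 : X), Paths g1 -> Paths g2 ->
    last r g1 = inl x1 -> last r g2 = inl x2 ->
    pdist g1 g2 >= eps * d x1 x2.

Definition lipschitz (d : X -> X -> R) (L : R) : Prop :=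
  forall (m : nat) (xs : nat -> X),
    exists Fs : nat -> V -> V -> R,
      (forall i, (i <= m)%N -> unit_flow_to (Fs i) (xs i)) /\
      \sum_(i < m) W1 (Fs i) (Fs i.+1) <= L * \sum_(i < m) d (xs i) (xs i.+1).

End MarkedDAG.

(* Main.v *)
(** The metric is dominated by random ultrametrics (Fakcharoenphol, Rao and
    Talwar) that expand every distance by O(log n) on average.  By Caratheodory's
    theorem at most n^2 + 1 of them, suitably weighted, have the same average
    expansion.  They become the branches of a single tree with N <= n^4 leaves;
    gluing the leaves that carry the same point gives the DAG.  Merging each
    cluster with its largest part bounds the depth of the tree by log2 N + 1, and
    letting theta be the proportion of leaves below an arc gives each path the
    weight 1 / N.  Since the distance between two paths only sees the longer of
    the two arcs at which they diverge, the merging does not change distances.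
    Given a sequence of points, some branch expands its length by O(log n): route
    all the flows through it. *)

Require Import Defs.
From HB Require Import structures.
From Stdlib Require Import Rdefinitions Rpower.
From mathcomp Require Import all_boot all_order all_algebra.
From mathcomp Require Import boolp classical_sets fsbigop reals Rstruct.
From mathcomp Require Import fintype finset perm zify ring lra.
Set Implicit Arguments. Unset Strict Implicit. Unset Printing Implicit Defensive.
Import Order.TTheory GRing.Theory Num.Theory.
Local Open Scope ring_scope.

(* Numerals and operations in arguments of type [R] are read as those of the
   MathComp ring structure on [R]. *)
Bind Scope ring_scope with R.

(** * Sparse averages *)

(* Caratheodory's argument: among more than [#|P|.+1] active indices there is a
   nontrivial relation, along which the weights move until one of them is 0. *)
Lemma sparse_weights (F : realFieldType) (T P : finType) (p : T -> F)
    (v : T -> P -> F) :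
  (forall t, 0 <= p t) -> 0 < \sum_t p t ->
  (forall q, \sum_t p t * v t q <= 0) ->
  exists p' : T -> F, (forall t, 0 <= p' t) /\ 0 < \sum_t p' t /\
    (forall q, \sum_t p' t * v t q <= 0) /\
    (#|[set t | p' t != 0%R]| <= #|P|.+1)%N.
Proof.
have [n] := ubnP #|[set t | p t != 0]|; elim: n p => // n IH p.
rewrite ltnS; set S := [set t | p t != 0] => leSn p0 sp pv.
have [leS|ltS] := leqP #|S| #|P|.+1; first by exists p.
(* One row per active index: the entry 1 stands for the total weight, the others for the
   constraints. There are more rows than columns, so a nonzero [z] annihilates [M]; moving along it
   changes neither the total nor any constraint sum. *)
pose M : 'M[F]_(#|S|, 1 + #|P|) :=
  row_mx (const_mx 1) (\matrix_(a, q) v (enum_val a) (enum_val q)).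
have /rowV0Pn [z /sub_kermxP zM z0] : kermx M != 0.
  rewrite -mxrank_eq0 mxrank_ker -lt0n subn_gt0.
  exact: leq_ltn_trans (rank_leq_col _) ltS.
pose y t := \sum_(a < #|S|) (if enum_val a == t then z 0 a else 0).
have sum_y (f : T -> F) : \sum_t y t * f t = \sum_a z 0 a * f (enum_val a).
  under eq_bigr => t _ do rewrite mulr_suml.
  rewrite exchange_big; apply: eq_bigr => a _ /=.
  rewrite (bigD1 (enum_val a)) //= eqxx big1 ?addr0 // => t.
  by rewrite eq_sym => /negPf ->; rewrite mul0r.
have yS t : y t != 0 -> t \in S.
  apply: contraNT => tS; rewrite /y big1 // => a _.
  by case: eqP => // eat; rewrite -eat enum_valP in tS.
have yE a : y (enum_val a) = z 0 a.
  rewrite /y (bigD1 a) //= eqxx big1 ?addr0 // => b /negPf nba.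
  by rewrite (inj_eq enum_val_inj) nba.
have y1 : \sum_t y t = 0.
  have := sum_y (fun=> 1); under eq_bigr do rewrite mulr1; move=> ->.
  move: zM => /matrixP /(_ 0 (lshift _ 0)); rewrite !mxE => {2}<-.
  by apply: eq_bigr => a _; rewrite /M row_mxEl mxE.
have yv q : \sum_t y t * v t q = 0.
  rewrite (sum_y (v^~ q)); move: zM => /matrixP /(_ 0 (rshift _ (enum_rank q))).
  rewrite !mxE => {2}<-.
  by apply: eq_bigr => a _; rewrite /M row_mxEr mxE enum_rankK.
have [t1 yt1] : exists t, 0 < y t.
  apply/existsP; apply: contraNT z0 => /existsPn yneg.
  apply/eqP/rowP => a; rewrite mxE -yE; apply/eqP; rewrite -oppr_eq0; apply/eqP.
  apply: (@psumr_eq0P _ _ predT (fun t => - y t)) => //.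
    by move=> t _; rewrite oppr_ge0 leNgt.
  by rewrite sumrN y1 oppr0.
(* The least ratio is the longest step that keeps all weights nonnegative; it cancels the weight of
   [t0]. *)
case: (@arg_minP _ _ _ t1 (fun t => 0 < y t) (fun t => p t / y t) yt1) => t0 yt0 mint0.
pose p' t := p t - p t0 / y t0 * y t.
have sum_p' (f : T -> F) :
    \sum_t p' t * f t = \sum_t p t * f t - p t0 / y t0 * \sum_t y t * f t.
  by rewrite mulr_sumr -sumrB; apply: eq_bigr => t _; rewrite /p'; ring.
apply: (IH p').
- apply: leq_trans leSn; apply: proper_card; apply/properP; split.
    apply/subsetP => t; rewrite inE => p't; apply: contraT => tS.
    have /eqP yt : y t == 0 by apply: contraNT tS; apply: yS.
    by move: tS p't; rewrite inE negbK /p' yt => /eqP ->; rewrite mulr0 subr0 eqxx.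
  exists t0; first by apply: yS; rewrite gt_eqF.
  by rewrite inE negbK /p' divfK ?subrr // gt_eqF.
- move=> t; rewrite /p' subr_ge0; have [yt|yt] := ltP 0 (y t).
    by rewrite -ler_pdivlMr // mint0.
  apply: le_trans (p0 t); apply: mulr_ge0_le0 => //.
  by rewrite divr_ge0 // ltW.
- have := sum_p' (fun=> 1); under eq_bigr do rewrite mulr1; move=> ->.
  under eq_bigr do rewrite mulr1.
  by under [X in _ - _ * X]eq_bigr do rewrite mulr1; rewrite y1 mulr0 subr0.
- by move=> q; rewrite (sum_p' (v^~ q)) yv mulr0 subr0.
Qed.

(** * Hierarchies *)

(* Hierarchically separated tree metrics, viewed as ultrametrics. *)
Record hst (F : realFieldType) (T : Type) (a : F) (U : T -> T -> F) : Prop := {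
  hst_xx : forall x, U x x = 0;
  hst_sym : forall x y, U x y = U y x;
  hst_tri : forall x y z, U x z <= Num.max (U x y) (U y z);
  hst_val : forall x y, x <> y -> exists j : nat, U x y = a * 12 ^+ j }.

(* [c k x] is a representative of the cluster of [x] at depth [k], and [h k x]
   the length of the arc from that cluster to the cluster of [x] at depth
   [k.+1]. *)
Record hierarchy (F : realFieldType) (T : finType) (U : T -> T -> F)
    (S : {set T}) (b : F) (c : nat -> T -> T) (h : nat -> T -> F) : Prop := {
  hier_in : forall k x, x \in S -> c k x \in S;
  hier_idem : forall k x, x \in S -> c k (c k x) = c k x;
  hier_root : forall x y, x \in S -> y \in S -> c 0%N x = c 0%N y;
  hier_refine : forall k x y, x \in S -> y \in S ->
    c k.+1 x = c k.+1 y -> c k x = c k y;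
  hier_leaf : forall k x, x \in S -> (#|S| < 2 ^ k)%N -> c k x = x;
  hier_gt0 : forall k x, x \in S -> 0 < h k x;
  hier_geom : forall k x, x \in S -> 12 * h k.+1 x <= h k x;
  hier_top : forall x, x \in S -> h 0%N x <= b;
  hier_arc : forall k x y, x \in S -> y \in S ->
    c k.+1 x = c k.+1 y -> h k x = h k y;
  hier_dist : forall k x y, x \in S -> y \in S ->
    c k x = c k y -> c k.+1 x <> c k.+1 y -> Num.max (h k x) (h k y) = U x y }.

Lemma hst_gt0 (F : realFieldType) (T : eqType) (a : F) (U : T -> T -> F) x y :
  0 < a -> hst a U -> x != y -> 0 < U x y.
Proof.
by move=> a0 Uh /eqP /(hst_val Uh) [j ->]; rewrite mulr_gt0 // exprn_gt0.
Qed.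

(** Nonzero values have the form [a * 12 ^+ j], so a strict inequality gains a whole factor 12. This
    is the source of 12-geometricity. *)
Lemma hst_gap (F : realFieldType) (T : eqType) (a : F) (U : T -> T -> F) x y z t :
  0 < a -> hst a U -> U x y < U z t -> 12 * U x y <= U z t.
Proof.
move=> a0 Uh; have [->|xy] := eqVneq x y.
  by rewrite (hst_xx Uh) mulr0; apply: ltW.
have [->|zt] := eqVneq z t.
  by rewrite (hst_xx Uh) => /ltW; rewrite leNgt (hst_gt0 a0 Uh xy).
have [j ->] := hst_val Uh (elimN eqP xy); have [k ->] := hst_val Uh (elimN eqP zt).
rewrite ltr_pM2l // ltr_eXn2l ?ltr1n // => jk.
by rewrite mulrCA ler_pM2l // -exprS ler_eXn2l ?ltr1n.
Qed.

(** Base case of the recursion. A hierarchy has clusters at every depth, so the only cluster repeats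
    forever, with lengths that shrink by 12 at each step. *)
Lemma singleton_hierarchy (F : realFieldType) (T : finType) (U : T -> T -> F)
    (S : {set T}) (b : F) :
  (#|S| <= 1)%N -> 0 < b -> exists c h, hierarchy U S b c h.
Proof.
move=> S1 b0; have eqS x y : x \in S -> y \in S -> x = y.
  by move=> xS yS; move/card_le1_eqP: S1 => /(_ _ _ xS yS).
exists (fun _ x => x), (fun k _ => b / 12 ^+ k); split => //.
- by move=> k x _; rewrite divr_gt0 // exprn_gt0.
- by move=> k x _; rewrite exprS invfM mulrCA mulVKf ?pnatr_eq0.
- by move=> x _; rewrite expr0 divr1.
Qed.

(* Every cluster is merged with its largest part, whose own parts are attached
   directly to the cluster by arcs of their own lengths.  Any other part has at
   most half of the points, hence the logarithmic depth. *)
Lemma hst_hierarchy (F : realFieldType) (T : finType) (a : F) (U : T -> T -> F)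
    (S : {set T}) (b : F) :
  0 < a -> hst a U -> S != set0 -> 0 < b ->
  (forall x y, x \in S -> y \in S -> U x y <= b) ->
  exists c h, hierarchy U S b c h.
Proof.
move=> a0 Uh.
have [n] := ubnP #|S|; elim: n S b => // n IH S b; rewrite ltnS => leSn S0 b0 Ub.
have [S1|S2] := leqP #|S| 1; first exact: singleton_hierarchy.
have [x0 x0S] := set0Pn _ S0.
have [u [v [uS vS UD]]] : exists u v, [/\ u \in S, v \in S &
    forall x y, x \in S -> y \in S -> U x y <= U u v].
  case: (@arg_maxP _ _ _ (x0, x0) (fun z => (z.1 \in S) && (z.2 \in S))
    (fun z => U z.1 z.2)) => [|[u v] /= /andP [uS vS] uvmax]; first by rewrite /= x0S.
  by exists u, v; split => // x y xS yS; apply: (uvmax (x, y)); rewrite /= xS.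
set D := U u v in UD.
have D0 : 0 < D.
  have /card_gt1P [x [y [xS yS xy]]] := S2.
  exact: lt_le_trans (hst_gt0 a0 Uh xy) (UD _ _ xS yS).
have Db : D <= b by apply: Ub.
have D12 : 12 * (D / 12) = D by rewrite mulrC divfK // pnatr_eq0.
(* By the ultrametric inequality, the open balls whose radius is the diameter [D] partition [S]:
   these are the parts. *)
pose E x := [set y in S | U x y < D].
have inE1 x y : (y \in E x) = (y \in S) && (U x y < D) by rewrite inE.
have ES x y : y \in E x -> y \in S by rewrite inE1 => /andP [].
have xE x : x \in S -> x \in E x by move=> xS; rewrite inE1 xS (hst_xx Uh).
have trD x y z : U x y < D -> U y z < D -> U x z < D.
  by move=> xy yz; apply: le_lt_trans (hst_tri Uh x y z) _; rewrite gt_max xy.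
have eqE x y : y \in E x -> E y = E x.
  rewrite inE1 => /andP [yS xy]; apply/setP => z; rewrite !inE1.
  case: (z \in S) => //=; apply/idP/idP; apply: trD => //.
  by rewrite (hst_sym Uh).
have neE x y : x \in S -> y \in S -> y \notin E x -> U x y = D.
  move=> xS yS; rewrite inE1 yS /= -leNgt => Dxy.
  by apply/eqP; rewrite eq_le Dxy UD.
have Eltn x : (#|E x| < n)%N.
  apply: leq_trans leSn; apply: proper_card; apply/properP; split.
    by apply/subsetP => y; apply: ES.
  have [uE|] := boolP (u \in E x); last by exists u.
  exists v => //; apply/negP => vE; move: uE vE; rewrite !inE1 uS vS /=.
  by rewrite (hst_sym Uh) => xu /(trD _ _ _ xu); rewrite ltxx.
have EU x y z : y \in E x -> z \in E x -> U y z <= D / 12.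
  move=> yE zE; rewrite ler_pdivlMr // mulrC; apply: (hst_gap a0 Uh).
  by move: yE zE; rewrite !inE1 => /andP [_ xy] /andP [_]; apply: trD; rewrite (hst_sym Uh).
(* The hierarchy is chosen as a function of the part, not of a point in it, so that all points of a
   part share it. *)
have /choice [ch chP] : forall B : {set T}, exists ch,
    (exists2 x, x \in S & B = E x) -> hierarchy U B (D / 12) ch.1 ch.2.
  move=> B; have [[x xS ->]|nB] := pselect (exists2 x, x \in S & B = E x); last first.
    by exists ((fun _ x => x), (fun _ _ => 0)).
  have [||c [h ?]] := IH (E x) (D / 12) (Eltn x) _ (divr_gt0 D0 (ltr0n F 12)).
  - by apply/set0Pn; exists x; apply: xE.
  - exact: EU.
  by exists (c, h).
pose cc B := (ch B).1; pose hh B := (ch B).2.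
have hierE x : x \in S -> hierarchy U (E x) (D / 12) (cc (E x)) (hh (E x)).
  by move=> xS; apply: chP; exists x.
case: (@arg_maxnP _ x0 (fun x => x \in S) (fun x => #|E x|) x0S) => x1 x1S x1max.
set H := E x1; have hierH : hierarchy U H (D / 12) (cc H) (hh H) := hierE _ x1S.
have nHE x y : x \notin H -> x \in S -> y \in E x -> y \notin H.
  move=> xH xS yE; apply: contra xH => yH.
  by rewrite /H -(eqE _ _ yH) (eqE _ _ yE) xE.
(* The part of [x] is disjoint from [H] and no larger, so it has at most half of the points. This
   pays for the level lost in [c] outside [H]. *)
have half x k : x \in S -> x \notin H -> (#|S| < 2 ^ k.+1)%N -> (#|E x| < 2 ^ k)%N.
  move=> xS xH; rewrite expnS mul2n -addnn => leS.
  have := leq_trans (leq_trans _ leS); have := x1max x xS.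
  have : (#|E x| + #|H| <= #|S|)%N.
    rewrite -cardsUI (_ : E x :&: H = set0) ?cards0 ?addn0.
      by apply/subset_leq_card/subsetP => y; rewrite inE => /orP [] /ES.
    apply/setP => y; rewrite in_setI in_set0; apply/negP => /andP [yE].
    exact/negP/(nHE _ _ xH xS yE).
  by move: leS; rewrite -/H; lia.
(* Points of [H] keep their depth, the root of [H] becoming the root of [S]; the other parts hang
   one level lower, on arcs of length [D]. *)
pose c k x := if k is k'.+1 then if x \in H then cc H k x else cc (E x) k' x else x1.
pose h k x := if x \in H then hh H k x else if k is k'.+1 then hh (E x) k' x else D.
have cH k x : x \in H -> c k.+1 x = cc H k.+1 x by rewrite /c => ->.
have cE k x : x \notin H -> c k.+1 x = cc (E x) k x by rewrite /c => /negPf ->.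
have hH k x : x \in H -> h k x = hh H k x by rewrite /h => ->.
have cHH k x : x \in H -> c k.+1 x \in H.
  by move=> xH; rewrite cH // (hier_in hierH).
have cEE k x : x \in S -> x \notin H -> c k.+1 x \in E x.
  by move=> xS xH; rewrite cE // (hier_in (hierE x xS)) // xE.
have cEH k x : x \in S -> x \notin H -> c k.+1 x \notin H.
  by move=> xS xH; apply: nHE xH xS (cEE _ _ xS xH).
have sameH k x y : x \in S -> y \in S -> c k.+1 x = c k.+1 y -> (x \in H) = (y \in H).
  move=> xS yS cxy; have [xH|xH] := boolP (x \in H); have [yH|yH] := boolP (y \in H) => //.
    by have := cEH k y yS yH; rewrite -cxy cHH.
  by have := cEH k x xS xH; rewrite cxy cHH.
have sameE k x y : x \in S -> y \in S -> x \notin H -> c k.+1 x = c k.+1 y -> E x = E y.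
  move=> xS yS xH cxy; have yH : y \notin H by rewrite -(sameH _ _ _ xS yS cxy).
  by rewrite -(eqE _ _ (cEE k x xS xH)) cxy (eqE _ _ (cEE k y yS yH)).
exists c, h; split.
- move=> [|k] x xS //=; have [xH|xH] := boolP (x \in H).
    exact/(ES x1)/(hier_in hierH).
  by apply/(ES x)/(hier_in (hierE x xS)); apply: xE.
- move=> [|k] x xS //; have [xH|xH] := boolP (x \in H).
    by rewrite [LHS]cH ?cHH // cH // (hier_idem hierH).
  rewrite [LHS]cE ?cEH // (eqE _ _ (cEE k x xS xH)) cE //.
  by rewrite (hier_idem (hierE x xS)) // xE.
- by [].
- move=> [|k] x y xS yS // cxy; have sH := sameH _ _ _ xS yS cxy.
  have [xH|xH] := boolP (x \in H); have yH := xH; rewrite sH in yH.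
    by move: cxy; rewrite !cH //; apply: (hier_refine hierH).
  have sE := sameE _ _ _ xS yS xH cxy; move: cxy; rewrite !cE // -sE.
  by apply: (hier_refine (hierE x xS)); [apply: xE|rewrite sE xE].
- move=> [|k] x xS; first by rewrite expn0 ltnNge ltnW.
  have [xH|xH] := boolP (x \in H) => ltS.
    rewrite cH //; apply: (hier_leaf hierH) => //; apply: leq_ltn_trans ltS.
    by apply/subset_leq_card/subsetP => y; apply: ES.
  by rewrite cE //; apply: (hier_leaf (hierE x xS)); [apply: xE|apply: half].
- move=> k x xS; rewrite /h; case: ifP => xH; first exact: (hier_gt0 hierH).
  by case: k => [|k] //; apply: (hier_gt0 (hierE x xS)); apply: xE.
- move=> k x xS; rewrite /h; case: ifP => xH; first exact: (hier_geom hierH).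
  case: k => [|k]; last by apply: (hier_geom (hierE x xS)); apply: xE.
  by rewrite -[leRHS]D12 ler_pM2l //; apply: (hier_top (hierE x xS)); apply: xE.
- move=> x xS; rewrite /h; case: ifP => // xH; apply: le_trans Db.
  apply: le_trans (hier_top hierH xH) _; rewrite -[leRHS]D12.
  by rewrite ler_peMl ?ler1n // divr_ge0 // ltW.
- move=> k x y xS yS cxy; have sH := sameH _ _ _ xS yS cxy.
  have [xH|xH] := boolP (x \in H); have yH := xH; rewrite sH in yH.
    by move: cxy; rewrite !hH // !cH //; apply: (hier_arc hierH).
  have sE := sameE _ _ _ xS yS xH cxy; rewrite /h (negPf xH) (negPf yH).
  case: k cxy => // k; rewrite !cE // -sE.
  by apply: (hier_arc (hierE x xS)); [apply: xE|rewrite sE xE].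
(* Two points of different parts are at distance [D] and separate at the root. One of them lies
   outside [H], on an arc of length [D]; an arc within [H] has length at most [D / 12], so the
   maximum is [D]. Pairs in one part inherit the equality. *)
- move=> k x y xS yS cxy ncxy.
  have [xH|xH] := boolP (x \in H); have [yH|yH] := boolP (y \in H).
  + rewrite !hH //; move: cxy ncxy; rewrite !(cH k) //; case: k => [|k].
      by move=> _; apply: (hier_dist hierH) => //; apply: (hier_root hierH).
    by rewrite !cH //; apply: (hier_dist hierH).
  + case: k cxy ncxy => [|k] cxy ncxy; last first.
      by have := sameH _ _ _ xS yS cxy; rewrite xH (negPf yH).
    have DU : U x y = D by apply: neE => //; rewrite (eqE _ _ xH).
    rewrite DU /h xH (negPf yH) max_r //; apply: le_trans (hier_top hierH xH) _.
    by rewrite ler_pdivrMr // ler_peMr ?ler1n // ltW.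
  + case: k cxy ncxy => [|k] cxy ncxy; last first.
      by have := sameH _ _ _ xS yS cxy; rewrite yH (negPf xH).
    have DU : U x y = D by rewrite (hst_sym Uh); apply: neE => //; rewrite (eqE _ _ yH).
    rewrite DU /h yH (negPf xH) max_l //; apply: le_trans (hier_top hierH yH) _.
    by rewrite ler_pdivrMr // ler_peMr ?ler1n // ltW.
  + rewrite /h (negPf xH) (negPf yH); case: k cxy ncxy => [|k] cxy.
      rewrite !cE // maxxx => ncxy; apply/esym/neE => //; apply/negP => yE.
      apply: ncxy; rewrite (eqE _ _ yE).
      by apply: (hier_root (hierE x xS)) => //; apply: xE.
    have sE := sameE _ _ _ xS yS xH cxy; move: cxy; rewrite !cE // -sE.
    by apply: (hier_dist (hierE x xS)); [apply: xE|rewrite sE xE].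
Qed.

(** * The DAG of a hierarchy *)

Lemma lcpE (X W : finType) (x0 : X + W) (g g' : seq (X + W)) k :
  (k < size g)%N -> (k < size g')%N ->
  (forall i, (i < k)%N -> nth x0 g i = nth x0 g' i) ->
  nth x0 g k != nth x0 g' k -> lcp g g' = k.
Proof.
elim: k g g' => [|k IH] [|a g] [|b g'] //= kg kg' same diff.
  by rewrite (negPf diff).
by have /= -> := same 0%N isT; rewrite eqxx (IH g g') // => i ik; apply: (same i.+1).
Qed.

Lemma zip_behead_map (T : Type) (f : nat -> T) j n :
  let s := [seq f k | k <- iota j n.+1] in
  zip s (behead s) = [seq (f k, f k.+1) | k <- iota j n].
Proof. by elim: n j => [|n IH] j //=; rewrite -IH. Qed.

Section GluedTree.

Variables (X Q : finType) (e : Q -> X) (F : Q -> Q -> R) (b : R).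
Variables (c : nat -> Q -> Q) (h : nat -> Q -> R) (K : nat) (q0 : Q).
Hypothesis hier : hierarchy F [set: Q] b c h.
Hypothesis F_xx : forall x, F x x = 0.
Hypothesis F_ge0 : forall x y, 0 <= F x y.
Hypothesis leafK : (#|Q| < 2 ^ K)%N.
Hypothesis e_surj : forall x, exists q, e q = x.

Let cI k q : c k (c k q) = c k q.
Proof. by apply: (hier_idem hier); rewrite inE. Qed.

Let cR k q q' : c k.+1 q = c k.+1 q' -> c k q = c k q'.
Proof. by apply: (hier_refine hier); rewrite inE. Qed.

Let cK q : c K q = q.
Proof. by apply: (hier_leaf hier); rewrite ?inE // cardsT. Qed.

(* Internal vertices are the clusters [(k, q)] at depth [k <= K], named by their
   representatives; every leaf [(K, q)] has a single further arc, to the sink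
   [e q]. *)
Definition gluedW := {s : 'I_K.+1 * Q | c s.1 s.2 == s.2}.

Local Notation V := (X + gluedW)%type.

Lemma node_subproof k q : c (k, c k q).1 (k, c k q).2 == (k, c k q).2.
Proof. by rewrite /= cI. Qed.

Definition node (k : 'I_K.+1) (q : Q) : gluedW :=
  exist _ (k, c k q) (node_subproof k q).

Definition lev (u : V) : nat :=
  match u with inl _ => K.+1 | inr s => (val s).1 end.

(** The vertex at depth [k] on the way from the root to the leaf [q], then the sink. The test makes
    [inord] exact. *)
Definition pos (k : nat) (q : Q) : V :=
  if (k <= K)%N then inr (node (inord k) q) else inl (e q).

Definition arc (u v : V) : bool :=
  [exists q, [&& (lev u <= K)%N, pos (lev u) q == u & pos (lev u).+1 q == v]].

(** For an arc the choice of the leaf does not matter: by [hier_arc] above depth [K], and because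
    there is a single leaf at depth [K]. *)
Definition len (u v : V) : R :=
  if [pick q | (pos (lev u) q == u) && (pos (lev u).+1 q == v)] is Some q
  then h (lev u) q else 0.

(* The share of the leaves below [u] that lie below [v], so that the product
   along a path telescopes to [1 / #|Q|]. *)
Definition frac (u v : V) : R :=
  #|[set q | (pos (lev u) q == u) && (pos (lev u).+1 q == v)]|%:R
  / #|[set q | pos (lev u) q == u]|%:R.

Definition root : V := pos 0 q0.

Definition tpath (q : Q) : seq V := mkseq (pos^~ q) K.+2.

Definition tflow (q : Q) (u v : V) : R := ((u, v) \in arcs (tpath q))%:R.

Lemma lev_pos k q : (k <= K.+1)%N -> lev (pos k q) = k.
Proof.
rewrite /pos leq_eqVlt ltnS => /orP [/eqP ->|kK]; first by rewrite ltnn.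
by rewrite kK /= inordK.
Qed.

Lemma lev_le u : (lev u <= K.+1)%N.
Proof. by case: u => [x|s] //=; apply: leqW; rewrite -ltnS. Qed.

Lemma pos_ex u : exists q, pos (lev u) q = u.
Proof.
case: u => [x|[[k q] /= kq]].
  by have [q <-] := e_surj x; exists q; rewrite /pos /= ltnn.
exists q; rewrite /pos -ltnS ltn_ord; congr inr; apply: val_inj => /=.
by rewrite inord_val (eqP kq).
Qed.

Lemma pos_eqE k q q' : (k <= K)%N -> (pos k q == pos k q') = (c k q == c k q').
Proof.
move=> kK; rewrite /pos kK; apply/eqP/eqP => [[]|ckq].
  by rewrite inordK.
by congr inr; apply: val_inj => /=; rewrite inordK // ckq.
Qed.

(** The bound [k < K] stops before the gluing: a sink can lie below several leaves and does not
    determine its predecessor. *)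
Lemma pos_refine k q q' : (k < K)%N -> pos k.+1 q = pos k.+1 q' -> pos k q = pos k q'.
Proof.
move=> kK /eqP; rewrite pos_eqE // => /eqP /cR ckq.
by apply/eqP; rewrite pos_eqE ?ckq // ltnW.
Qed.

Lemma posK_inj q q' : pos K q = pos K q' -> q = q'.
Proof. by move=> /eqP; rewrite pos_eqE // !cK => /eqP. Qed.

Lemma pos_root q : pos 0 q = root.
Proof. by apply/eqP; rewrite /root pos_eqE // (hier_root hier (y := q0)) ?inE. Qed.

Lemma arc_pos k q : (k <= K)%N -> arc (pos k q) (pos k.+1 q).
Proof. by move=> kK; apply/existsP; exists q; rewrite lev_pos ?eqxx ?kK // leqW. Qed.

Lemma arcP u v : reflect (exists2 q, (lev u <= K)%N &
  u = pos (lev u) q /\ v = pos (lev u).+1 q) (arc u v).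
Proof.
apply: (iffP existsP) => [[q /and3P [lu /eqP pu /eqP pv]]|[q lu [pu pv]]].
  by exists q.
by exists q; rewrite lu -pu -pv !eqxx.
Qed.

Lemma arc_lev u v : arc u v -> lev v = (lev u).+1.
Proof. by case/arcP => q lu [_ ->]; rewrite lev_pos. Qed.

Lemma len_pos k q : (k <= K)%N -> len (pos k q) (pos k.+1 q) = h k q.
Proof.
move=> kK; rewrite /len lev_pos ?leqW //; case: pickP => [q'|/(_ q)]; last first.
  by rewrite !eqxx.
move: kK; rewrite leq_eqVlt => /orP [/eqP -> /andP [/eqP /posK_inj -> //]|kK].
rewrite !pos_eqE ?(ltnW kK) // => /andP [_ /eqP cq].
by apply: (hier_arc hier); rewrite ?inE.
Qed.

Lemma sinkP v : reflect (lev v = K.+1) (is_sink arc v).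
Proof.
apply: (iffP forallP) => [nv|lv w].
  apply/eqP; rewrite eqn_leq lev_le /= ltnNge; apply/negP => lv.
  have [q pq] := pos_ex v; move: (nv (pos (lev v).+1 q)); rewrite -{1}pq.
  by rewrite arc_pos.
by apply/negP => /arcP [q]; rewrite lv ltnn.
Qed.

Lemma srcP v : reflect (v = root) (is_src arc v).
Proof.
apply: (iffP forallP) => [nv|-> w]; last first.
  by apply/negP => /arc_lev; rewrite lev_pos.
have [q pq] := pos_ex v; rewrite -pq; case lv : (lev v) => [|k]; first exact: pos_root.
have := nv (pos k q); rewrite -pq lv arc_pos // -ltnS -lv.
exact: lev_le.
Qed.

(** * Paths from the root to the sinks *)

Lemma path_lev v p : path arc v p -> lev (last v p) = (lev v + size p)%N.
Proof.
elim: p v => [|w p IH] v /=; first by rewrite addn0.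
by case/andP => /arc_lev vw /IH ->; rewrite vw addSnnS.
Qed.

(** Gluing creates no new paths: a vertex of depth at most [K] determines its ancestors, so the path
    follows one leaf. Only for the last arc must the leaf be taken from the arc itself, as the sink
    does not determine it. *)
Lemma path_to_sink v p : path arc v p -> is_sink arc (last v p) ->
  exists2 q, v = pos (lev v) q &
    p = [seq pos k q | k <- iota (lev v).+1 (K.+1 - lev v)].
Proof.
elim: p v => [|w p IH] v /=.
  move=> _ /sinkP lv; have [q pq] := pos_ex v; exists q; first by rewrite pq.
  by rewrite lv subnn.
case/andP => vw wp /(IH _ wp) [q wq pE]; have lw := arc_lev vw.
case/arcP: vw => q1 lv [vq1 wq1].
have [lvK|lvK] := ltnP (lev v) K.
  exists q; last by rewrite subSn //= {1}wq {1}lw pE lw subSS.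
  by rewrite {1}vq1; apply: pos_refine => //; rewrite -wq1 -lw.
have {lv}lvK : lev v = K by apply/eqP; rewrite eqn_leq lv.
exists q1 => //; rewrite lvK subSnn /= -lvK -wq1; congr cons.
by rewrite pE lw lvK subnn.
Qed.

Lemma tpathE q : tpath q = root :: [seq pos k q | k <- iota 1 K.+1].
Proof. by rewrite /tpath /mkseq /= pos_root. Qed.

Lemma nth_tpath k q : (k <= K.+1)%N -> nth root (tpath q) k = pos k q.
Proof. by move=> kK; rewrite nth_mkseq. Qed.

Lemma last_tpath q : last root (tpath q) = inl (e q).
Proof.
rewrite -nth_last size_mkseq nth_tpath //= /pos ltnn //.
Qed.

Lemma tpath_path j n q : (j + n <= K.+1)%N ->
  path arc (pos j q) [seq pos k q | k <- iota j.+1 n].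
Proof.
elim: n j => [|n IH] j //=; rewrite -addSnnS => jn.
by rewrite arc_pos ?IH // -ltnS (leq_trans _ jn) // leq_addr.
Qed.

Lemma PathsP g : Paths arc root g <-> exists q, g = tpath q.
Proof.
split=> [[p [-> [rp /(path_to_sink rp) [q _]]]]|[q ->]].
  by rewrite lev_pos // subn0 => ->; exists q; rewrite tpathE.
exists [seq pos k q | k <- iota 1 K.+1]; split; first exact: tpathE.
split; first by rewrite -(pos_root q); apply: tpath_path.
have := last_tpath q; rewrite tpathE /= => ->.
by apply/sinkP.
Qed.

Lemma tpath_inj : injective tpath.
Proof.
move=> q q' /(congr1 (fun g => nth root g K)).
by rewrite !nth_tpath ?leqW //; apply: posK_inj.
Qed.

Lemma arcs_tpath q :
  arcs (tpath q) = [seq (pos k q, pos k.+1 q) | k <- iota 0 K.+1].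
Proof.
exact: zip_behead_map.
Qed.

Lemma mem_arcs u v q : ((u, v) \in arcs (tpath q)) =
  [&& (lev u <= K)%N, pos (lev u) q == u & pos (lev u).+1 q == v].
Proof.
rewrite arcs_tpath; apply/mapP/and3P => [[k]|[lu /eqP pu /eqP pv]].
  rewrite mem_iota add0n ltnS => kK [-> ->].
  by rewrite lev_pos ?leqW // kK !eqxx.
by exists (lev u); rewrite ?mem_iota // pu pv.
Qed.

(** * Marking, distances and path weights *)

Lemma glued_geometric : geometric arc len (12%:R)%R.
Proof.
move=> u v w uv vw; have lv := arc_lev uv; case/arcP: vw => q lv' [vq wq].
case/arcP: uv => q1 lu [uq1 vq1]; rewrite lv in lv' vq wq.
have uq : u = pos (lev u) q.
  by rewrite {1}uq1; apply: pos_refine => //; rewrite -vq -vq1.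
rewrite uq vq wq !len_pos //.
by apply: (hier_geom hier); rewrite inE.
Qed.

Lemma glued_marked : is_marked arc root len frac.
Proof.
have arc_sum u (q : Q) : (lev u <= K)%N -> pos (lev u) q = u -> arc u (pos (lev u).+1 q).
  by move=> lu pu; rewrite -{1}pu arc_pos.
have len_gt0 u v : arc u v -> 0 < len u v.
  by case/arcP => q lu [uq vq]; rewrite uq vq len_pos // (hier_gt0 hier) ?inE.
split; [split; [|split]|split; [|split; [|split]]] => //.
- move=> v p vp p0; apply/eqP => /(congr1 lev); rewrite path_lev //.
  by rewrite -[RHS]addn0 => /addnI /eqP; rewrite size_eq0 (negPf p0).
- by move=> v; split => [/srcP|/srcP].
- move=> v; split => [/sinkP|[x ->]]; last exact/sinkP.
  by case: v => [x|s] /=; [exists x|have := ltn_ord (val s).1; move=> + ls; rewrite ls ltnn].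
- move=> u v w uv vw; have := glued_geometric uv vw; have := len_gt0 _ _ vw; lra.
- move=> u v /arcP [q lu [uq vq]]; rewrite divr_gt0 // ltr0n card_gt0.
    by apply/set0Pn; exists q; rewrite inE -uq -vq !eqxx.
  by apply/set0Pn; exists q; rewrite inE -uq.
move=> u ux; have [q pq] := pos_ex u.
have lu : (lev u <= K)%N.
  by case: u ux {pq} => [x /(_ x)|s _] //=; rewrite -ltnS.
rewrite -mulr_suml -natr_sum.
set S := [set q | pos (lev u) q == u].
have S0 : #|S|%:R != 0 :> R.
  by rewrite pnatr_eq0 cards_eq0; apply/set0Pn; exists q; rewrite inE pq.
rewrite -[RHS](divff S0); congr (_%:R / _); rewrite -[RHS]sum1_card.
rewrite [RHS](partition_big (pos (lev u).+1) (arc u)).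
  by apply: eq_bigr => v _; rewrite -sum1_card; apply: eq_bigl => q'; rewrite !inE.
by move=> q'; rewrite inE => /eqP; apply: arc_sum.
Qed.

Lemma pdist_tpath q q' : pdist root len (tpath q) (tpath q') = F q q'.
Proof.
rewrite /pdist (inj_eq tpath_inj); case: eqVneq => [->|qq']; first by rewrite F_xx.
(* The first depth at which the clusters differ is positive, as the root is shared, and at most [K],
   as leaves are single points. The paths thus diverge before the gluing, where [hier_dist]
   applies. *)
have ex : exists k, c k q != c k q' by exists K; rewrite !cK.
case: (ex_minnP ex) => -[|k]; first by rewrite (hier_root hier (y := q')) ?inE ?eqxx.
move=> ck mink; have kK : (k < K)%N by apply: mink; rewrite !cK.
have ck' : c k q = c k q'.
  by apply/eqP; apply: contraT => /mink; rewrite ltnn.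
have kK' := ltnW kK.
have -> : lcp (tpath q) (tpath q') = k.+1.
  apply: (@lcpE _ _ root); rewrite ?size_mkseq ?ltnS ?(leqW kK) //.
    move=> i ik; have iK : (i <= K)%N := ltnW (leq_trans ik kK).
    rewrite !nth_tpath ?leqW //; apply/eqP; rewrite pos_eqE //.
    by apply: contraT => /mink; rewrite leqNgt ik.
  by rewrite !nth_tpath ?leqW // pos_eqE.
rewrite succnK !nth_tpath ?(leqW kK) ?(leqW kK') // !len_pos //.
by apply: (hier_dist hier); rewrite ?inE //; apply/eqP.
Qed.

Lemma theta_tpath q : theta_path frac (tpath q) = #|Q|%:R^-1.
Proof.
pose n k : R := #|[set q' | c k q' == c k q]|%:R.
have n0 k : n k != 0.
  by rewrite pnatr_eq0 cards_eq0; apply/set0Pn; exists q; rewrite inE.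
have nK : n K = 1.
  rewrite /n (_ : [set q' | _] = [set q]) ?cards1 //.
  by apply/setP => q'; rewrite !inE !cK.
have fracE k : (k < K)%N -> frac (pos k q) (pos k.+1 q) = n k.+1 / n k.
  move=> kK; have lk : lev (pos k q) = k by rewrite lev_pos // ltnW // leqW.
  rewrite /frac lk; congr (_%:R / _%:R); apply: eq_card => q'; rewrite !inE.
    rewrite -[in RHS]pos_eqE //; apply: andb_idl => /eqP /pos_refine -> //.
  by rewrite pos_eqE // ltnW.
(* The arc into a sink leaves a vertex with a single leaf below it, hence it has fraction 1 and the
   telescoping product ends at [n K = 1]. *)
have fracK : frac (pos K q) (pos K.+1 q) = 1.
  have lK : lev (pos K q) = K by rewrite lev_pos.
  transitivity (n K / n K); last by rewrite nK divr1.
  rewrite /frac lK; congr (_%:R / _%:R).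
    apply: eq_card => q'; rewrite !inE -[in RHS]pos_eqE //.
    by apply: andb_idr => /eqP /posK_inj ->.
  by apply: eq_card => q'; rewrite !inE pos_eqE.
rewrite /theta_path arcs_tpath big_map.
rewrite -[iota 0 K.+1]/(index_iota 0 K.+1) big_nat_recr //= fracK mulr1.
rewrite (eq_big_nat _ _ (F2 := fun k => n k.+1 / n k)); last first.
  by move=> k /= kK; rewrite fracE.
have K0 : (0 < K)%N.
  by move: leafK; case: (K) => //; rewrite expn0 ltnS leqn0 => /eqP /card0_eq /(_ q0); rewrite inE.
rewrite (telescope_prodf (f := n)) // nK /n div1r; congr (_%:R^-1).
by apply: eq_card => q'; rewrite !inE (hier_root hier (y := q)) ?inE ?eqxx.
Qed.

(** * Flows along single paths and their transport cost *)

Lemma outflow_tflow q u :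
  outflow arc (tflow q) u = ((lev u <= K)%N && (pos (lev u) q == u))%:R.
Proof.
rewrite /outflow /tflow; have [/andP [lu /eqP pu]|nu] := boolP (_ && _); last first.
  by rewrite big1 // => v _; rewrite mem_arcs andbA (negPf nu).
have uv : arc u (pos (lev u).+1 q) by rewrite -{1}pu arc_pos.
rewrite (bigD1 (pos (lev u).+1 q)) //= mem_arcs lu pu !eqxx big1 ?addr0 // => v /andP [_ /negPf vq].
by rewrite mem_arcs [_ == v]eq_sym vq !andbF.
Qed.

Lemma inflow_tflow q v :
  inflow arc (tflow q) v = ((0 < lev v)%N && (pos (lev v) q == v))%:R.
Proof.
rewrite /inflow /tflow; have [/andP [lv /eqP pv]|nv] := boolP (_ && _); last first.
  rewrite big1 // => u uv; rewrite mem_arcs -(arc_lev uv); move: nv.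
  by rewrite (arc_lev uv) /= => /negPf ->; rewrite !andbF.
have lv1 : ((lev v).-1 <= K)%N by rewrite -ltnS prednK // lev_le.
have uv : arc (pos (lev v).-1 q) v by rewrite -{2}pv -{2}(prednK lv) arc_pos.
have lu : lev (pos (lev v).-1 q) = (lev v).-1 by rewrite lev_pos // leqW.
rewrite (bigD1 (pos (lev v).-1 q)) //= mem_arcs lu lv1 prednK // pv !eqxx big1 ?addr0 //.
move=> u /andP [/arc_lev -> /=]; rewrite mem_arcs eq_sym => /negPf ->.
by rewrite andbF.
Qed.

Lemma tflow_unit q : unit_flow_to arc root (tflow q) (e q).
Proof.
split; [split; [split|]|].
- by move=> u v _; rewrite /tflow ler0n.
- move=> u ux ur; rewrite outflow_tflow inflow_tflow.
  have -> : (lev u <= K)%N.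
    by case: u ux {ur} => [x /(_ x)|s _] //=; rewrite -ltnS.
  have -> // : (0 < lev u)%N.
  rewrite lt0n; apply/eqP => lu0; apply: ur.
  by have [q' <-] := pos_ex u; rewrite lu0 pos_root.
- by rewrite outflow_tflow lev_pos // pos_root eqxx.
- move=> y ye; rewrite inflow_tflow /= /pos ltnn /=.
  by case: eqP => // -[yE]; case: ye.
Qed.

Lemma fsum_Paths (f : seq V -> R) :
  \sum_(g \in Paths arc root) f g = \sum_q f (tpath q).
Proof.
have -> : Paths arc root = [set` [seq tpath q | q <- enum Q]]%classic.
  apply/seteqP; split=> g /=.
    by case/PathsP => q ->; apply: map_f; rewrite mem_enum.
  by case/mapP => q _ ->; apply/PathsP; exists q.
rewrite -fsbig_seq; last by rewrite (map_inj_uniq tpath_inj) enum_uniq.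
by rewrite big_map big_enum.
Qed.

(** Supplies the lower bound without which the infimum in [W1] could not be compared with its
    members. *)
Lemma OT_ge0 mu mu' : 0 <= OT arc root len mu mu'.
Proof.
rewrite /OT; set S := (X in inf X).
have [->|S0] := eqVneq S classical_sets.set0; first by rewrite inf0.
apply: lb_le_inf; first exact/set0P.
move=> _ [p [[p0 _] ->]]; rewrite /transport_cost fsum_Paths sumr_ge0 // => q _.
rewrite fsum_Paths sumr_ge0 // => q' _; rewrite mulr_ge0 ?pdist_tpath //.
by apply: p0; apply/PathsP; [exists q|exists q'].
Qed.

(** Dirac masses on the two paths represent the flows, and the cost of their product coupling is the
    distance of the paths. *)
Lemma W1_tflow q q' :
  W1 arc root len (tflow q) (tflow q') <= pdist root len (tpath q) (tpath q').
Proof.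
pose mu q (g : seq V) : R := (g == tpath q)%:R.
have sum_mu q1 (f : seq V -> R) : \sum_(g \in Paths arc root) mu q1 g * f g = f (tpath q1).
  rewrite fsum_Paths (bigD1 q1) //= /mu eqxx mul1r big1 ?addr0 // => q2.
  by rewrite (inj_eq tpath_inj) => /negPf ->; rewrite mul0r.
have sum_mu1 q1 : \sum_(g \in Paths arc root) mu q1 g = 1.
  by have := sum_mu q1 (fun=> 1); under eq_fsbigr do rewrite mulr1.
have rep q1 : represents arc root (mu q1) (tflow q1).
  split; first by split => [g _|//]; rewrite ler0n.
  by move=> u v _; rewrite (sum_mu q1 (fun g => ((u, v) \in arcs g)%:R)).
apply: (@le_trans _ _ (OT arc root len (mu q) (mu q'))).
  apply: ge_inf; last by exists (mu q), (mu q').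
  by exists 0 => _ [m [m' [_ [_ ->]]]]; apply: OT_ge0.
apply: ge_inf.
  exists 0 => _ [p [[p0 _] ->]]; rewrite /transport_cost fsum_Paths sumr_ge0 // => q1 _.
  rewrite fsum_Paths sumr_ge0 // => q2 _; rewrite mulr_ge0 ?pdist_tpath //.
  by apply: p0; apply/PathsP; [exists q1|exists q2].
exists (fun g g' => mu q g * mu q' g'); split.
  split; [by move=> g g' _ _; rewrite mulr_ge0 ?ler0n|split].
    move=> g _; rewrite -[RHS](sum_mu q' (fun=> mu q g)).
    by apply: eq_fsbigr => g' _; rewrite mulrC.
  by move=> g' _; rewrite -[RHS](sum_mu q (fun=> mu q' g')).
pose D := pdist root len.
rewrite -[LHS](sum_mu q (fun g => D g (tpath q'))); apply: eq_fsbigr => g _.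
rewrite -(sum_mu q' (fun g' => mu q g * D g g')); apply: eq_fsbigr => g' _.
by rewrite mulrCA mulrA.
Qed.

End GluedTree.

(** * Random ultrametrics *)

Section FirstPoint.

Variable X : finType.

Definition prank (s : {perm X}) (z : X) : nat := enum_rank (s z).

Lemma prank_inj s : injective (prank s).
Proof. by move=> z w /val_inj /enum_rank_inj /perm_inj. Qed.

Definition isfirst (s : {perm X}) (B : {set X}) (z : X) : bool :=
  (z \in B) && [forall w in B, (prank s z <= prank s w)%N].

Lemma isfirst_uniq s B z w : isfirst s B z -> isfirst s B w -> z = w.
Proof.
case/andP => zB /forall_inP zmin /andP [wB /forall_inP wmin].
by apply: (@prank_inj s); apply/eqP; rewrite eqn_leq zmin ?wmin.
Qed.

Lemma isfirst_ex s B : B != set0 -> exists z, isfirst s B z.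
Proof.
case/set0Pn => x xB; case: (@arg_minnP _ x (fun z => z \in B) (prank s) xB) => z zB zmin.
by exists z; rewrite /isfirst zB; apply/forall_inP.
Qed.

(** Composing with the transposition of [z] and [w] exchanges their ranks, which maps the orders
    with [z] first injectively to orders with [w] first. *)
Lemma card_isfirst_sym (B : {set X}) z w : z \in B -> w \in B ->
  (#|[set s | isfirst s B z]| <= #|[set s | isfirst s B w]|)%N.
Proof.
move=> zB wB; rewrite -(card_imset _ (mulgI (tperm z w))).
apply/subset_leq_card/subsetP => _ /imsetP [s + ->]; rewrite !inE.
have rk v : prank (tperm z w * s)%g v = prank s (tperm z w v) by rewrite /prank permM.
case/andP => _ /forall_inP zmin; rewrite /isfirst wB; apply/forall_inP => v vB.
by rewrite !rk tpermR zmin //; case: tpermP.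
Qed.

(** The permutations are partitioned by the first point of [B], and by symmetry all classes have the
    same size. *)
Lemma card_isfirst (B : {set X}) z : z \in B ->
  (#|[set s | isfirst s B z]| * #|B|)%N = #|{perm X}|.
Proof.
move=> zB; have B0 : B != set0 by apply/set0Pn; exists z.
rewrite mulnC -sum_nat_const -[RHS]sum1_card.
have /choice [f fP] : forall s, exists w, isfirst s B w by move=> s; apply: isfirst_ex.
rewrite (partition_big f (mem B)) => [|s _]; last by case/andP: (fP s).
apply: eq_bigr => w wB; rewrite sum1_card.
transitivity #|[set s | isfirst s B w]|.
  by apply/eqP; rewrite eqn_leq !card_isfirst_sym.
apply: eq_card => s; rewrite !inE; apply/idP/eqP => [|<-] //.
exact: isfirst_uniq.
Qed.

Lemma card_first_in (A B : {set X}) (f : {perm X} -> X) : A \subset B -> B != set0 ->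
  (forall s, isfirst s B (f s)) ->
  (#|[set s | f s \in A]| * #|B|)%N = (#|A| * #|{perm X}|)%N.
Proof.
move=> AB B0 fP; rewrite -[RHS]sum_nat_const -[in LHS]sum1_card big_distrl /=.
rewrite (partition_big f (mem A)) => [|s]; last by rewrite inE.
apply: eq_bigr => w wA; rewrite -(card_isfirst (subsetP AB w wA)).
rewrite -big_distrl /= sum1_card; congr (_ * _)%N.
apply: eq_card => s; rewrite !inE; apply/andP/idP => [[_ /eqP <-] //|sw].
by rewrite inE -(isfirst_uniq sw (fP s)); split.
Qed.

End FirstPoint.

(** * Logarithms and shifted sums *)

Lemma ln_lower (a b : R) : 0 < a -> 0 < b -> 1 - a / b <= ln b - ln a.
Proof.
move=> a0 b0.
have ab0 : 0 < a / b by rewrite divr_gt0.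
(* This is [1 + t <= exp t] at [t = ln (a / b)]. *)
have /RleP := exp_ineq1_le (ln (a / b)%R); rewrite exp_ln; last exact/RltP.
rewrite -RinvE -RmultE ln_mult; [|exact/RltP|by apply/RltP; rewrite RinvE invr_gt0].
rewrite ln_Rinv; last exact/RltP.
rewrite !RplusE RmultE RinvE RoppE R1E; lra.
Qed.

Lemma ln_le (a b : R) : 0 < a -> a <= b -> ln a <= ln b.
Proof.
move=> a0 ab; have b0 : 0 < b by apply: lt_le_trans ab.
have := ln_lower a0 b0; suff: a / b <= 1 by lra.
by rewrite ler_pdivrMr // mul1r.
Qed.

Lemma ln_natX (n k : nat) : (0 < n)%N -> ln (n ^ k)%N%:R = k%:R * ln n%:R.
Proof.
by move=> n0; rewrite natrX -RpowE ln_pow ?INRE //; apply/RltP; rewrite ltr0n.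
Qed.

Lemma half_lt_ln (n : nat) : (2 <= n)%N -> 1 / 2 < ln n%:R.
Proof.
move=> n2; have E2 : IZR 2 = 2%:R by rewrite (IZRposE 2) INRE.
have /RltP := ln_lt_2; rewrite RinvE !E2.
have : ln 2 <= ln n%:R by apply: ln_le; rewrite ?ltr0n // ler_nat.
lra.
Qed.

(** A shift by [m] is a sum of [m] unit shifts, and for each of them the sum over [k] telescopes. *)
Lemma sum_shift_le (a : nat -> R) K m : {homo a : i j / (i <= j)%N >-> i <= j} ->
  \sum_(k < K) (a (k + m)%N - a k) <= m%:R * (a (K + m)%N - a 0%N).
Proof.
move=> am.
have shift (k : 'I_K) : a (k + m)%N - a k = \sum_(i < m) (a (k + i).+1 - a (k + i)%N).
  rewrite -(big_mkord xpredT (fun i => a (k + i).+1 - a (k + i)%N)).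
  by rewrite (@telescope_sumr_eq _ 0 m (fun i => a (k + i)%N)) ?addn0 // => i _; rewrite addnS.
under eq_bigr do rewrite shift.
rewrite exchange_big /= mulr_natl -[X in _ *+ X](card_ord m) -sumr_const.
apply: ler_sum => i _.
rewrite -(big_mkord xpredT (fun k => a (k + i).+1 - a (k + i)%N)).
rewrite (@telescope_sumr_eq _ 0 K (fun k => a (k + i)%N)) //= add0n lerB //.
  by apply: am; rewrite leq_add2l ltnW.
exact: am.
Qed.

(** * Separation of two points at one scale *)

Section Cut.

Variables (X : finType) (d : X -> X -> R).
Hypothesis dm : is_metric d.

Lemma dxx x : d x x = 0.
Proof. by apply/dm.1. Qed.

Lemma dsym x y : d x y = d y x.
Proof. exact: dm.2.1. Qed.

Lemma dtri x y z : d x z <= d x y + d y z.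
Proof. exact: dm.2.2. Qed.

Lemma d_ge0 x y : 0 <= d x y.
Proof. have := dtri x y x; rewrite dxx (dsym y x); lra. Qed.

Lemma d_gt0 x y : x != y -> 0 < d x y.
Proof. by move=> xy; rewrite lt0r d_ge0 andbT; apply: contra xy => /eqP /dm.1 ->. Qed.

Definition ball (x : X) (rho : R) : {set X} := [set z | d x z <= rho].

Definition lnb (x : X) (rho : R) : R := ln #|ball x rho|%:R.

(** The center of Fakcharoenphol, Rao and Talwar: the first point of the ball in the order [s]. *)
Definition ctr (s : {perm X}) (rho : R) (x : X) : X :=
  [arg min_(z < x | z \in ball x rho) prank s z].

Lemma ball_refl x (rho : R) : 0 <= rho -> x \in ball x rho.
Proof. by rewrite inE dxx. Qed.

Lemma ballS x (rho rho' : R) : rho <= rho' -> ball x rho \subset ball x rho'.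
Proof. by move=> rr; apply/subsetP => z; rewrite !inE => /le_trans ->. Qed.

Lemma card_ball_gt0 x (rho : R) : 0 <= rho -> (0 < #|ball x rho|)%N.
Proof. by move=> r0; apply/card_gt0P; exists x; apply: ball_refl. Qed.

Lemma lnb_le x (rho rho' : R) : 0 <= rho -> rho <= rho' -> lnb x rho <= lnb x rho'.
Proof.
move=> r0 rr; apply: ln_le; first by rewrite ltr0n card_ball_gt0.
by rewrite ler_nat; apply/subset_leq_card/ballS.
Qed.

Lemma lnb_ge0 x (rho : R) : 0 <= rho -> 0 <= lnb x rho.
Proof.
move=> r0; have <- : ln 1 = 0 := ln_1.
by apply: ln_le; rewrite ?ltr01 // ler1n card_ball_gt0.
Qed.

Lemma lnb_max x (rho : R) : 0 <= rho -> lnb x rho <= ln #|X|%:R.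
Proof.
by move=> r0; apply: ln_le; rewrite ?ltr0n ?card_ball_gt0 // ler_nat max_card.
Qed.

Lemma ctrP s (rho : R) x : 0 <= rho -> isfirst s (ball x rho) (ctr s rho x).
Proof.
move=> r0; rewrite /ctr; case: arg_minnP; first exact: ball_refl.
by move=> z zB zmin; rewrite /isfirst zB; apply/forall_inP.
Qed.

Lemma ctr_in s (rho : R) x : 0 <= rho -> d x (ctr s rho x) <= rho.
Proof. by move=> /(ctrP s x) /andP []; rewrite inE. Qed.

(** If each center lay in the ball of the other point, each would have rank at most that of the
    other. *)
Lemma ctr_cut s (rho : R) x y : 0 <= rho -> ctr s rho x != ctr s rho y ->
  (rho < d y (ctr s rho x)) || (rho < d x (ctr s rho y)).
Proof.
move=> r0; apply: contraR; rewrite negb_or -!leNgt => /andP [yx xy].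
have /andP [_ /forall_inP xmin] := ctrP s x r0.
have /andP [_ /forall_inP ymin] := ctrP s y r0.
by apply/eqP/(@prank_inj _ s)/eqP; rewrite eqn_leq xmin ?ymin ?inE.
Qed.

(* The center of [x] cuts [y] off only if it lies in the annulus
   [ball x rho :\: ball x (rho - t)], and it is uniformly distributed in
   [ball x rho].  Bounding the proportion of the annulus by a difference of
   logarithms makes the sum over all scales telescope. *)
Lemma cut_prob x y (rho t : R) : d x y <= t -> t <= rho ->
  #|[set s | rho < d y (ctr s rho x)]|%:R
    <= #|{perm X}|%:R * (lnb x rho - lnb x (rho - t)).
Proof.
move=> dt tr; have t0 : 0 <= t := le_trans (d_ge0 x y) dt.
have r0 : 0 <= rho := le_trans t0 tr.
have rt0 : 0 <= rho - t by rewrite subr_ge0.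
set B := ball x rho; set B' := ball x (rho - t).
have B'B : B' \subset B by apply: ballS; lra.
pose A := [set z in B | rho < d y z].
have AB : A \subset B by apply/subsetP => z; rewrite inE => /andP [].
have B0 : B != set0 by rewrite -card_gt0 card_ball_gt0.
have /(congr1 (fun n : nat => n%:R : R)) := card_first_in AB B0 (fun s => ctrP s x r0).
have -> : [set s | ctr s rho x \in A] = [set s | rho < d y (ctr s rho x)].
  by apply/setP => s; rewrite !inE ctr_in.
rewrite !natrM => cE.
have Bp : 0 < #|B|%:R :> R by rewrite ltr0n card_ball_gt0.
have B'p : 0 < #|B'|%:R :> R by rewrite ltr0n card_ball_gt0.
have AB' : (#|A| + #|B'| <= #|B|)%N.
  rewrite -cardsUI (_ : A :&: B' = set0) ?cards0 ?addn0.
    by apply/subset_leq_card; rewrite subUset AB.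
  apply/setP => z; rewrite /A /B' !inE; apply/negP => /andP [/andP [_ yz] xz].
  by have := dtri y x z; rewrite (dsym y x); lra.
have lnB := ln_lower B'p Bp.
rewrite -(ler_pM2r Bp) cE mulrC -mulrA ler_wpM2l //.
rewrite -ler_pdivrMr //; apply: le_trans lnB.
rewrite ler_pdivrMr // mulrBl mul1r divfK ?gt_eqF // lerBrDr -natrD.
by rewrite ler_nat.
Qed.

(* [K] equally spaced radii stand for a uniformly random radius in [[r, 2r]]. *)
Definition rad (K : nat) (r : R) (k : nat) : R := r + k%:R * (r / K%:R).

Lemma rad_ge0 K (r : R) k : 0 <= r -> 0 <= rad K r k.
Proof. by move=> r0; rewrite addr_ge0 // mulr_ge0 // divr_ge0. Qed.

Lemma rad_le K (r : R) (k : 'I_K) : 0 <= r -> rad K r k <= 2 * r.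
Proof.
move=> r0; have K0 : 0 < K%:R :> R by rewrite ltr0n (leq_trans _ (ltn_ord k)).
rewrite /rad mulrDl !mul1r lerD2l mulrCA ler_piMr // ler_pdivrMr // mul1r ler_nat.
exact: ltnW.
Qed.

Definition cut (K : nat) (r : R) (x y : X) : {set {perm X} * 'I_K} :=
  [set w : {perm X} * 'I_K | rad K r w.2 < d y (ctr w.1 (rad K r w.2) x)].

Lemma card_cut (K : nat) (r : R) (x y : X) :
  #|cut K r x y| = (\sum_(k < K) #|[set s | (rad K r k < d y (ctr s (rad K r k) x))%R]|)%N.
Proof.
rewrite -sum1_card (partition_big snd xpredT) //=; apply: eq_bigr => k _.
rewrite sum1_card -[RHS](card_imset _ (f := fun s : {perm X} => (s, k))); last first.
  by move=> s t [].
apply: eq_card => -[s k']; rewrite [LHS]inE /= inE /=.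
apply/andP/imsetP => [[h /eqP kk']|[t + [-> ->]]].
  by exists s; rewrite ?inE -kk'.
by rewrite inE.
Qed.

(** Sum [cut_prob] over the radii with a shift of [m] steps: [sum_shift_le] yields [m] times the
    growth of [lnb] from [r / 2] to [2 * r], and [m] steps have length at most [2 * d x y]. *)
Lemma cut_le (K : nat) (r : R) (x y : X) :
  (0 < K)%N -> 0 < r -> x != y -> r / K%:R <= d x y -> 4 * d x y <= r ->
  r * #|cut K r x y|%:R <= #|{: {perm X} * 'I_K}|%:R *
    (2 * d x y * (lnb x (2 * r) - lnb x (r / 2))).
Proof.
move=> K0 r0 xy sD D4; have D0 := d_gt0 xy.
have K0' : 0 < K%:R :> R by rewrite ltr0n.
set st := r / K%:R in sD; have st0 : 0 < st by rewrite divr_gt0.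
have stK : K%:R * st = r by rewrite mulrC divfK // gt_eqF.
(* Rounding [d x y] up to whole steps at most doubles it, since a step is no longer than [d x y]. *)
have [m [Dm mD]] : exists m : nat, d x y <= m%:R * st /\ m%:R * st <= 2 * d x y.
  exists (Num.trunc (d x y / st)).+1.
  have /andP [lo hi] := truncn_itv (divr_ge0 (ltW D0) (ltW st0)).
  split; first by rewrite -ler_pdivrMr // ltW.
  rewrite -natr1 mulrDl mul1r mulrDl mul1r lerD //.
  by rewrite -ler_pdivlMr.
(* As [4 * d x y <= r], the arguments start no lower than [r / 2]; at index [K + m] they reach
   [2 * r]. *)
pose a k := lnb x (r - m%:R * st + k%:R * st).
have apos k : 0 <= r - m%:R * st + k%:R * st.
  have : 0 <= k%:R * st by rewrite mulr_ge0 // ltW.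
  by lra.
have am : {homo a : i j / (i <= j)%N >-> i <= j}.
  by move=> i j ij; apply: lnb_le => //; rewrite lerD2l ler_wpM2r ?ler_nat // ltW.
have step (k : 'I_K) : #|[set s | rad K r k < d y (ctr s (rad K r k) x)]|%:R
    <= #|{perm X}|%:R * (a (k + m)%N - a k).
  apply: le_trans (cut_prob Dm _) _.
    rewrite /rad -/st; have : 0 <= k%:R * st by rewrite mulr_ge0 // ltW.
    by lra.
  rewrite ler_wpM2l // /a /rad -/st natrD.
  by rewrite le_eqVlt; apply/orP; left; apply/eqP; congr (lnb _ _ - lnb _ _); ring.
have total : #|cut K r x y|%:R <= #|{perm X}|%:R * (m%:R * (lnb x (2 * r) - lnb x (r / 2))).
  rewrite card_cut natr_sum; apply: le_trans (ler_sum _ (fun k _ => step k)) _.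
  rewrite -mulr_sumr ler_wpM2l //; apply: le_trans (sum_shift_le _ _ am) _.
  rewrite ler_wpM2l // lerB // /a.
    rewrite natrD le_eqVlt; apply/orP; left; apply/eqP; congr lnb.
    by rewrite -stK; ring.
  by rewrite mul0r addr0; apply: lnb_le; lra.
have l0 : 0 <= lnb x (2 * r) - lnb x (r / 2) by rewrite subr_ge0; apply: lnb_le; lra.
rewrite card_prod card_ord natrM; apply: le_trans (ler_wpM2l (ltW r0) total) _.
set l : R := lnb x (2 * r) - lnb x (r / 2) in l0 *.
set P : R := #|{perm X}|%:R.
have -> : r * (P * (m%:R * l)) = P * K%:R * (m%:R * st * l) by rewrite -{1}stK; ring.
by rewrite ler_wpM2l ?mulr_ge0 ?ler0n // ler_wpM2r.
Qed.

End Cut.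

Lemma sum_pow12 (a : R) n : 0 <= a ->
  \sum_(j < n.+1) a * 12 ^+ j <= 2 * (a * 12 ^+ n).
Proof.
move=> a0; elim: n => [|n IH].
  by rewrite big_ord1 expr0 mulr1 ler_peMl // ler1n.
rewrite big_ord_recr /= exprS; have : 0 <= a * 12 ^+ n by rewrite mulr_ge0 // exprn_ge0.
rewrite (mulrCA a); move: (\sum_(_ < _) _) (a * 12 ^+ n) IH => s t; lra.
Qed.

(** If the last term is below [M], the whole geometric sum is at most twice that term; otherwise the
    last term contributes nothing. *)
Lemma sum_pow12_lt (a M : R) n : 0 <= a -> 0 <= M ->
  \sum_(j < n) (if M <= a * 12 ^+ j then 0 else a * 12 ^+ j) <= 2 * M.
Proof.
move=> a0 M0; elim: n => [|n IH]; first by rewrite big_ord0 mulr_ge0.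
rewrite big_ord_recr /=; case: (leP M (a * 12 ^+ n)) => [_|/ltW lM]; first by rewrite addr0.
apply: le_trans (_ : 2 * (a * 12 ^+ n) <= _); last by rewrite ler_pM2l.
apply: le_trans (sum_pow12 n a0); rewrite big_ord_recr /= lerD2r.
by apply: ler_sum => j _; case: ifP => // _; rewrite mulr_ge0 // exprn_ge0.
Qed.

(** * The ultrametric built from all scales *)

Section Scales.

Variables (X : finType) (d : X -> X -> R) (delta : R) (J K : nat).
Hypotheses (dm : is_metric d) (K_gt0 : (0 < K)%N) (delta_gt0 : 0 < delta).
Hypothesis delta_lt : forall x y, x != y -> 2 * delta < d x y.

Local Notation Omega := ({perm X} * 'I_K)%type.

Definition scale (j : nat) : R := delta * 12 ^+ j.

Hypothesis d_scale : forall x y, d x y <= scale J.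
Hypothesis scaleK : forall x y, x != y -> scale J / K%:R <= d x y.

Definition center (w : Omega) (j : nat) (x : X) : X :=
  ctr d w.1 (rad K (scale j) w.2) x.

(** The coarsest scale with different centers decides. A common center at scale [j.+1] puts two
    points within [4 * scale j.+1 = 48 * scale j], hence the factor 48. *)
Definition frt (w : Omega) (x y : X) : R :=
  \big[Order.max/0]_(j < J.+1)
    (if center w j x != center w j y then 48 * scale j else 0).

Lemma scale_gt0 j : 0 < scale j.
Proof. by rewrite mulr_gt0 // exprn_gt0. Qed.

Lemma scaleS j : scale j.+1 = 12 * scale j.
Proof. by rewrite /scale exprS mulrCA. Qed.

Lemma scale_le i j : (i <= j)%N -> scale i <= scale j.
Proof. by move=> ij; rewrite ler_pM2l // ler_weXn2l ?ler1n. Qed.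

Lemma radius_ge0 (w : Omega) j : 0 <= rad K (scale j) w.2.
Proof. exact/rad_ge0/ltW/scale_gt0. Qed.

Lemma center_dist w j x y : center w j x = center w j y -> d x y <= 4 * scale j.
Proof.
move=> cxy; have := dtri dm x (center w j x) y; rewrite {2}cxy (dsym dm (center w j y) y).
have := ctr_in dm w.1 x (radius_ge0 w j); have := ctr_in dm w.1 y (radius_ge0 w j).
have := rad_le w.2 (ltW (scale_gt0 j)); rewrite /center; lra.
Qed.

(** At scale 0 the radii are at most [2 * delta], less than any positive distance. *)
Lemma center0 w x : center w 0 x = x.
Proof.
apply/eqP; apply: contraT => cx; have := delta_lt cx; rewrite (dsym dm).
have := ctr_in dm w.1 x (radius_ge0 w 0); have := rad_le w.2 (ltW (scale_gt0 0)).
rewrite /center /scale expr0 mulr1; lra.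
Qed.

(** At scale [J] every ball is the whole space. *)
Lemma centerJ w x y : center w J x = center w J y.
Proof.
have bT z : ball d z (rad K (scale J) w.2) = [set: X].
  apply/setP => t; rewrite !inE; apply: le_trans (d_scale z t) _.
  by rewrite lerDl mulr_ge0 // divr_ge0 // ltW // scale_gt0.
have := ctrP dm w.1 x (radius_ge0 w J); have := ctrP dm w.1 y (radius_ge0 w J).
by rewrite !bT => cy cx; apply: isfirst_uniq cx cy.
Qed.

Lemma frt_term w j x y : (j <= J)%N ->
  center w j x != center w j y -> 48 * scale j <= frt w x y.
Proof.
move=> jJ cxy; have jJ1 : (j < J.+1)%N by [].
have := @le_bigmax _ _ _ 0 (fun j : 'I_J.+1 =>
  if center w j x != center w j y then 48 * scale j else 0) (Ordinal jJ1).
by rewrite /= cxy.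
Qed.

Lemma frt_ge0 w x y : 0 <= frt w x y.
Proof. exact: bigmax_ge_id. Qed.

Lemma frt_le w x y (b : R) : 0 <= b ->
  (forall j, (j <= J)%N -> center w j x != center w j y -> 48 * scale j <= b) ->
  frt w x y <= b.
Proof.
by move=> b0 bP; apply: bigmax_le => // j _; case: ifP => // /bP; apply; rewrite -ltnS.
Qed.

Lemma frt_hst w : hst (48 * delta) (frt w).
Proof.
split.
- move=> x; apply/eqP; rewrite eq_le frt_ge0 andbT.
  by apply: frt_le => // j _; rewrite eqxx.
- by move=> x y; apply: eq_bigr => j _; rewrite eq_sym.
- move=> x y z; apply: frt_le => [|j jJ cxz]; first by rewrite le_max frt_ge0.
  rewrite le_max; have [cxy|/(frt_term jJ) -> //] := eqVneq (center w j x) (center w j y).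
  by rewrite cxy in cxz; rewrite (frt_term jJ cxz) orbT.
- move=> x y /eqP xy; have U0 : 0 < frt w x y.
    apply: lt_le_trans (frt_term (j := 0) _ _); rewrite ?center0 //.
    by rewrite mulr_gt0 // scale_gt0.
  have [|j _] := @eq_bigmax _ _ _ 0 (@ord0 J) xpredT (fun j : 'I_J.+1 =>
    if center w j x != center w j y then 48 * scale j else 0) isT.
    by move=> j _; case: ifP => // _; rewrite mulr_ge0 // ltW // scale_gt0.
  rewrite -/(frt w x y) => Uj; exists j; move: U0; rewrite Uj.
  by case: ifP => //; rewrite ?ltxx // /scale mulrA.
Qed.

Lemma frt_dominates w x y : d x y <= frt w x y.
Proof.
(* At the finest scale with a common center the distance is bounded; one scale below, the centers
   differ and [frt] is large enough. *)
have ex : exists j, center w j x == center w j y by exists J; rewrite (centerJ w x y).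
case: (ex_minnP ex) => -[|j] /eqP cj minj.
  by rewrite !center0 in cj; rewrite cj (dxx dm) frt_ge0.
have jJ : (j < J)%N by apply: minj; rewrite (centerJ w x y).
apply: le_trans (center_dist cj) _; rewrite scaleS.
have /(frt_term (ltnW jJ)) : center w j x != center w j y.
  by apply/negP => /minj; rewrite ltnn.
lra.
Qed.

Lemma frt_top w x y : frt w x y <= 48 * delta * 12 ^+ J.
Proof.
rewrite -mulrA; apply: frt_le => [|j jJ _]; first by rewrite mulr_ge0 // ltW // scale_gt0.
by rewrite ler_pM2l // scale_le.
Qed.

(** The maximum is at most the sum, and [ctr_cut] charges each separation to a cut seen from [x] or
    from [y]. *)
Lemma frt_le_cuts w x y : frt w x y <= \sum_(j < J.+1) 48 *
  (scale j * (w \in cut d K (scale j) x y)%:R + scale j * (w \in cut d K (scale j) y x)%:R).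
Proof.
have term_ge0 j : 0 <= 48 * (scale j * (w \in cut d K (scale j) x y)%:R
    + scale j * (w \in cut d K (scale j) y x)%:R).
  by rewrite mulr_ge0 // addr_ge0 // mulr_ge0 // ltW // scale_gt0.
apply: frt_le => [|j jJ cxy]; first exact: sumr_ge0.
have jJ1 : (j < J.+1)%N by [].
rewrite (bigD1 (Ordinal jJ1)) //=; apply: ler_wpDr; first exact: sumr_ge0.
rewrite ler_pM2l // -mulrDr ler_peMr ?(ltW (scale_gt0 j)) //.
have := ctr_cut dm (radius_ge0 w j) cxy; rewrite !inE.
case: (_ < d y _) => /= [_|->]; first by rewrite lerDl.
by rewrite lerDr.
Qed.

(** Scales below [4 * d x y] form a geometric sum of at most [8 * d x y]. For the others [cut_le]
    applies; since [2 * scale j <= scale j.+1 / 2], its logarithmic differences telescope to at most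
    [ln #|X|%:R]. *)
Lemma sum_cuts x y : x != y ->
  \sum_w \sum_(j < J.+1) scale j * (w \in cut d K (scale j) x y)%:R
    <= #|{: Omega}|%:R * (8 * d x y + 2 * d x y * ln #|X|%:R).
Proof.
move=> xy; have D0 := d_gt0 dm xy.
pose g j := lnb d x (scale j / 2).
have s0 j : 0 <= scale j / 2 by rewrite divr_ge0 // ltW // scale_gt0.
have gS j : g j <= g j.+1.
  by apply: lnb_le => //; have := scale_gt0 j; rewrite scaleS; lra.
rewrite exchange_big /=.
apply: (@le_trans _ _ (\sum_(j < J.+1) #|{: Omega}|%:R *
    ((if 4 * d x y <= scale j then 0 else scale j) + 2 * d x y * (g j.+1 - g j)))).
  apply: ler_sum => j _; rewrite -mulr_sumr -natr_sum.
  rewrite (_ : (\sum_w (w \in cut d K (scale j) x y))%N = #|cut d K (scale j) x y|).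
    2: by rewrite -sum1_card [RHS]big_mkcond; apply: eq_bigr => w _; case: ifP.
  have [D4|_] := leP (4 * d x y) (scale j).
    rewrite add0r; apply: le_trans (cut_le dm K_gt0 (scale_gt0 j) xy _ D4) _.
      apply: le_trans (scaleK xy); rewrite ler_wpM2r ?invr_ge0 //.
      by apply: scale_le; rewrite -ltnS.
    rewrite ler_wpM2l // ler_wpM2l ?mulr_ge0 ?(ltW D0) // lerD2r.
    apply: lnb_le => //; first by rewrite mulr_ge0 // ltW // scale_gt0.
    by rewrite scaleS; have := scale_gt0 j; lra.
  rewrite mulrC; apply: ler_pM => //; first exact/ltW/scale_gt0.
    by rewrite ler_nat max_card.
  by rewrite lerDl mulr_ge0 ?mulr_ge0 ?(ltW D0) // subr_ge0.
rewrite -mulr_sumr ler_wpM2l // big_split lerD //=.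
  have := sum_pow12_lt J.+1 (ltW delta_gt0) (mulr_ge0 (ler0n _ 4) (ltW D0)).
  by rewrite mulrA -natrM.
rewrite -mulr_sumr ler_wpM2l ?mulr_ge0 ?(ltW D0) //.
rewrite -(big_mkord xpredT (fun j => g j.+1 - g j)) telescope_sumr //.
have := lnb_max dm x (s0 J.+1); have := lnb_ge0 dm x (s0 0%N); rewrite /g; lra.
Qed.

(** With [l] for the logarithm, the two families of cuts give [(16 + 4 * l) * d x y], at most
    [36 * l * d x y] because [l > 1 / 2]; and [48 * 36 = 1728]. *)
Lemma frt_average x y : (2 <= #|X|)%N ->
  \sum_w frt w x y <= #|{: Omega}|%:R * (1728 * ln #|X|%:R * d x y).
Proof.
move=> X2; have [->|xy] := eqVneq x y.
  rewrite (dxx dm) !mulr0 big1 // => w _; exact: (hst_xx (frt_hst w)).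
have ln2 := half_lt_ln X2.
have yx : y != x by rewrite eq_sym.
have := sum_cuts xy; have := sum_cuts yx; rewrite (dsym dm y x).
have : \sum_w frt w x y <= 48 *
    (\sum_w \sum_(j < J.+1) scale j * (w \in cut d K (scale j) x y)%:R +
     \sum_w \sum_(j < J.+1) scale j * (w \in cut d K (scale j) y x)%:R).
  rewrite -big_split mulr_sumr; apply: ler_sum => w _ /=.
  apply: le_trans (frt_le_cuts w x y) _.
  by rewrite -mulr_sumr ler_pM2l // big_split.
have D0 := d_gt0 dm xy; set N : R := #|{: Omega}|%:R; have N0 : 0 <= N by [].
have : N * (16 * d x y) <= N * (32 * ln #|X|%:R * d x y).
  by rewrite ler_wpM2l // ler_pM2r //; lra.
move: (\sum_w frt w x y) (\sum_w _) (\sum_w _) (ln _) => a1 a2 a3 l.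
nra.
Qed.

End Scales.

(** * Assembling the branches *)

Lemma glued_tree (X Q : finType) (e : Q -> X) (F : Q -> Q -> R) (a b : R) (q0 : Q) :
  0 < a -> hst a F -> 0 < b -> (forall p q, F p q <= b) ->
  (forall x, exists q, e q = x) ->
  exists (W : finType) (A : rel (X + W)%type) (r : (X + W)%type)
      (omega theta : (X + W)%type -> (X + W)%type -> R)
      (P : Q -> seq (X + W)%type) (f : Q -> (X + W)%type -> (X + W)%type -> R),
    [/\ is_marked A r omega theta, geometric A omega (12%:R)%R,
        forall g, Paths A r g <-> exists q, g = P q &
        forall q, [/\ last r (P q) = inl (e q),
          nb_arcs (P q) = (trunc_log 2 #|Q|).+2,
          theta_path theta (P q) = #|Q|%:R^-1,
          unit_flow_to A r (f q) (e q) &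
          forall q', pdist r omega (P q) (P q') = F q q' /\
            W1 A r omega (f q) (f q') <= F q q']].
Proof.
move=> a0 Fh b0 Fb e_surj.
have F_ge0 p q : 0 <= F p q.
  have [->|] := eqVneq p q; first by rewrite (hst_xx Fh).
  by move/(hst_gt0 a0 Fh)/ltW.
have QT0 : [set: Q] != set0 by apply/set0Pn; exists q0; rewrite inE.
have [c [h hier]] := hst_hierarchy a0 Fh QT0 b0 (fun p q _ _ => Fb p q).
(* The least depth at which [hier_leaf] makes all clusters single points. *)
pose K := (trunc_log 2 #|Q|).+1.
have leafK : (#|Q| < 2 ^ K)%N by apply: trunc_log_ltn.
exists {s : 'I_K.+1 * Q | c s.1 s.2 == s.2}, (arc e hier), (root e K q0 hier).
exists (len e hier), (frac e hier), (tpath e K hier), (tflow e hier).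
split.
- exact: glued_marked.
- exact: glued_geometric.
- exact: PathsP.
move=> q; split.
- exact: last_tpath.
- by rewrite /nb_arcs size_mkseq.
- exact: theta_tpath.
- exact: tflow_unit.
move=> q'; rewrite -(pdist_tpath e q0 hier (hst_xx Fh) leafK).
by split => //; apply: (W1_tflow _ _ (hst_xx Fh)).
Qed.

Lemma exists_scales (X : finType) (d : X -> X -> R) : is_metric d ->
  exists (delta : R) (J K : nat), [/\ (0 < K)%N, 0 < delta,
    (forall x y, x != y -> 2 * delta < d x y),
    (forall x y, d x y <= scale delta J) &
    (forall x y, x != y -> scale delta J / K%:R <= d x y)].
Proof.
move=> dm.
have [m [m0 dmin]] : exists m : R, 0 < m /\ forall x y, x != y -> m <= d x y.
  case: (pickP (fun z : X * X => z.1 != z.2)) => [z0 z0P|none]; last first.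
    by exists 1; split => // x y xy; have := none (x, y); rewrite /= xy.
  case: (@arg_minP _ _ _ z0 (fun z => z.1 != z.2) (fun z => d z.1 z.2) z0P) => z zP zmin.
  by exists (d z.1 z.2); split => [|x y xy]; [exact: d_gt0 | exact: (zmin (x, y))].
pose M := \sum_x \sum_y d x y.
have dM x y : d x y <= M.
  rewrite /M (bigD1 x) //= (bigD1 y) //= -!addrA lerDl addr_ge0 ?sumr_ge0 // => [z _|z _].
    exact: d_ge0.
  by apply: sumr_ge0 => t _; apply: d_ge0.
have M0 : 0 <= M by apply: sumr_ge0 => x _; apply: sumr_ge0 => y _; apply: d_ge0.
have delta0 : 0 < m / 4 by rewrite divr_gt0.
(* An Archimedean bound serves as exponent because [J < 12 ^ J]. *)
pose J := Num.bound (M / (m / 4)).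
have J12 : M <= scale (m / 4) J.
  rewrite /scale -ler_pdivrMl // mulrC; apply/ltW.
  apply: lt_le_trans (archi_boundP _) _; first by rewrite divr_ge0 // ltW.
  by rewrite -natrX ler_nat ltnW // ltn_expl.
(* Enough radii for the step at the top scale to be at most the least distance [m]. *)
pose K := Num.bound (scale (m / 4) J / m).
have K1 := archi_boundP (divr_ge0 (ltW (scale_gt0 delta0 J)) (ltW m0)).
have K0 : (0 < K)%N.
  by rewrite -(ltr0n R); apply: le_lt_trans K1; rewrite divr_ge0 // ltW // scale_gt0.
exists (m / 4), J, K; split => //.
- by move=> x y /dmin; lra.
- by move=> x y; apply: le_trans (dM x y) J12.
- move=> x y /dmin md; apply: le_trans md.
  have := ltW K1; rewrite -/K ler_pdivrMr // ler_pdivrMr ?ltr0n //.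
  by rewrite [_ * m]mulrC.
Qed.

(** Different branches are put at distance [b]. Taking for [b] an admissible value [a * 12 ^+ J]
    that bounds all others keeps the union an ultrametric of the same kind. *)
Definition join_hst (I X : finType) (U : I -> X -> X -> R) (b : R) (p q : I * X) : R :=
  if p.1 == q.1 then U p.1 p.2 q.2 else b.

Lemma join_hstP (I X : finType) (U : I -> X -> X -> R) (a : R) (J : nat) :
  0 < a -> (forall i, hst a (U i)) -> (forall i x y, U i x y <= a * 12 ^+ J) ->
  hst a (join_hst U (a * 12 ^+ J)).
Proof.
move=> a0 Uh Ub; rewrite /join_hst; split.
- by move=> p; rewrite eqxx (hst_xx (Uh _)).
- by move=> p q; rewrite eq_sym; case: eqP => // ->; rewrite (hst_sym (Uh _)).
- move=> p q s; case: (eqVneq p.1 q.1) => [->|pq]; case: (eqVneq q.1 s.1) => [qs|qs].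
  + exact: (hst_tri (Uh _)).
  + by rewrite le_max lexx orbT.
  + by rewrite -qs (negPf pq) le_max lexx.
  + by rewrite maxxx; case: ifP => //.
- move=> [i x] [j y] /= pq; case: eqVneq => [ij|_]; last by exists J.
  by apply: (hst_val (Uh i)) => xy; apply: pq; rewrite ij xy.
Qed.

Lemma frt_marked_dag (X : finType) (d : X -> X -> R) :
  is_metric d -> (2 <= #|X|)%N ->
  exists (W : finType) (A : rel (X + W)%type) (r : (X + W)%type)
         (omega theta : (X + W)%type -> (X + W)%type -> R),
    [/\ is_marked A r omega theta, geometric A omega 12, expanding A r omega d 1,
        lipschitz A r omega d (1728 * ln #|X|%:R) &
        depth0 A r + depthI A r theta <= 1728 * ln #|X|%:R].
Proof.
move=> dm X2.
have [delta [J [K [K0 delta0 delta_lt d_scale scaleK]]]] := exists_scales dm.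
set L : R := 1728 * ln #|X|%:R.
set Omega := ({perm X} * 'I_K)%type.
pose U := @frt X d delta J K.
have Uavg := frt_average dm K0 delta0 delta_lt scaleK _ _ X2.
(* Equal weights satisfy the constraints by [frt_average]. With one constraint per pair of points,
   at most [n ^ 2 + 1] ultrametrics stay active. *)
have [|||p [p0 [sp [pU pS]]]] := @sparse_weights R Omega (X * X)%type (fun=> 1)
    (fun w z => U w z.1 z.2 - L * d z.1 z.2).
- by [].
- rewrite sumr_const ltr0n card_prod card_ord muln_gt0 K0 andbT.
  by apply/card_gt0P; exists 1%g.
- move=> z; under eq_bigr do rewrite mul1r; rewrite big_split /= sumr_const.
  by rewrite mulNrn -mulr_natl subr_le0; apply: Uavg.
set S := [set w | p w != 0] in pS.
pose I := {w : Omega | w \in S}.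
(* The constraints add up along the sequence, so the excess [f] has nonpositive weighted sum; as the
   total weight is positive, [f w <= 0] for some active [w]. *)
have U_seq (m : nat) (xs : nat -> X) : exists i : I,
    \sum_(k < m) U (val i) (xs k) (xs k.+1) <= L * \sum_(k < m) d (xs k) (xs k.+1).
  pose f w := \sum_(k < m) (U w (xs k) (xs k.+1) - L * d (xs k) (xs k.+1)).
  have pf : \sum_w p w * f w <= 0.
    under eq_bigr => w _ do rewrite mulr_sumr.
    by rewrite exchange_big sumr_le0 // => k _; apply: (pU (xs k, xs k.+1)).
  have [w wS fw] : exists2 w, w \in S & f w <= 0.
    apply/exists_inP; apply: contraLR pf; rewrite negb_exists_in => /forall_inP fpos.
    rewrite -ltNge; have [w wS] : exists w, w \in S.
      apply/set0Pn; apply: contraTN sp => /eqP S0; rewrite -leNgt sumr_le0 // => w _.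
      by have := in_set0 w; rewrite -S0 inE => /negbFE/eqP ->.
    have pos w' : w' \in S -> 0 < p w' * f w'.
      by move=> w'S; rewrite mulr_gt0 // ?ltNge ?fpos // -ltNge lt0r p0 andbT; rewrite inE in w'S.
    rewrite (bigD1 w) //= ltr_pwDl ?pos // sumr_ge0 // => w' _.
    have [/pos/ltW //|] := boolP (w' \in S).
    by rewrite inE negbK => /eqP ->; rewrite mul0r.
  by exists (exist _ w wS); move: fw; rewrite /f sumrB -mulr_sumr subr_le0.
have x0 : X by case: (pickP (fun _ : X => true)) X2 => // /eq_card0 ->.
have [i0 _] := U_seq 0%N (fun=> x0).
pose Q : finType := (I * X)%type; pose e (q : Q) := q.2.
pose a := 48 * delta; have a0 : 0 < a by rewrite mulr_gt0.
pose b := a * 12 ^+ J; have b0 : 0 < b by rewrite mulr_gt0 // exprn_gt0.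
pose F : Q -> Q -> R := join_hst (fun i : I => U (val i)) b.
have Fh : hst a F.
  apply: join_hstP => // i *; first exact: frt_hst.
  exact: frt_top.
have Fb p1 p2 : F p1 p2 <= b.
  by rewrite /F /join_hst; case: ifP => // _; apply: frt_top.
have e_surj x : exists q, e q = x by exists (i0, x).
have [W [A [r [omega [theta [P [f [mk geo PP Pq]]]]]]]] :=
  glued_tree (i0, x0) a0 Fh b0 Fb e_surj.
(* Makes paths in different branches expanding; within a branch [frt_dominates] does. *)
have db x y : d x y <= b.
  apply: le_trans (d_scale x y) _; rewrite /b /a -mulrA ler_peMl ?ler1n //.
  exact/ltW/scale_gt0.
have expA : expanding A r omega d 1.
  move=> g1 g2 x1 x2 /PP [q1 ->] /PP [q2 ->].
  have [-> _ _ _ /(_ q2) [-> _]] := Pq q1; have [-> _ _ _ _] := Pq q2.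
  move=> [<-] [<-]; rewrite mul1r /F /join_hst; case: ifP => _ //.
  exact: frt_dominates.
have lipA : lipschitz A r omega d L.
  move=> m xs; have [i iU] := U_seq m xs.
  exists (fun k => f (i, xs k)); split => [k _|]; first by have [] := Pq (i, xs k).
  apply: le_trans iU; apply: ler_sum => k _.
  have [_ _ _ _ /(_ (i, xs k.+1)) [_ W1le]] := Pq (i, xs k).
  by apply: le_trans W1le _; rewrite /F /join_hst eqxx.
have n0 : (0 < #|X|)%N by apply: ltnW.
(* For [n >= 2] one has [(n ^ 2 + 1) * n <= n ^ 4]. *)
have Qn : (#|Q| <= #|X| ^ 4)%N.
  rewrite card_prod card_sig; move: pS; rewrite card_prod; move: X2 => {}X2.
  rewrite (eq_card (B := S)) // => Sn; apply: leq_trans (leq_mul Sn (leqnn _)) _.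
  by move: X2; move: #|X| => n n2; rewrite !expnS expn0; nia.
have Q0 : (0 < #|Q|)%N by apply/card_gt0P; exists (i0, x0).
have lnQ : ln #|Q|%:R <= 4 * ln #|X|%:R.
  by rewrite -ln_natX //; apply: ln_le; rewrite ?ltr0n // ler_nat.
have ln2 := half_lt_ln X2.
have depth : (trunc_log 2 #|Q|)%:R <= 2 * ln #|Q|%:R.
  have : ln (2 ^ trunc_log 2 #|Q|)%N%:R <= ln #|Q|%:R.
    by apply: ln_le; rewrite ?ltr0n ?expn_gt0 // ler_nat; apply: trunc_logP.
  rewrite ln_natX //; have := half_lt_ln (leqnn 2).
  have : 0 <= (trunc_log 2 #|Q|)%:R :> R by [].
  move: (_%:R) (ln 2) (ln _) => t l2 l; nra.
have ex : Paths A r (P (i0, x0)) by apply/PP; exists (i0, x0).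
have d0 : depth0 A r <= (trunc_log 2 #|Q|).+2%:R.
  apply: ge_sup; first by exists (nb_arcs (P (i0, x0)))%:R; exists (P (i0, x0)).
  by move=> _ [g /PP [q ->] <-]; have [_ -> _ _ _] := Pq q.
have dI : depthI A r theta <= ln #|Q|%:R.
  apply: ge_sup; first by exists (ln (1 / theta_path theta (P (i0, x0)))); exists (P (i0, x0)).
  move=> _ [g /PP [q ->] <-]; have [_ _ -> _ _] := Pq q.
  by rewrite RdivE R1E div1r invrK.
exists W, A, r, omega, theta; split => //.
(* The depths add up to at most [3 * ln #|Q|%:R + 2], hence to at most 16 times the logarithm of
   [#|X|]. *)
apply: le_trans (lerD d0 dI) _; rewrite /L -addn2 natrD; lra.
Qed.

(* Restores the default, under which the theorem is stated. *)
Bind Scope R_scope with R.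

Theorem theorem2p2 :
  exists C : R, 0 < C /\
  forall (X : finType) (d : X -> X -> R), is_metric d -> (2 <= #|X|)%N ->
  exists (W : finType) (A : rel (X + W)%type) (r : (X + W)%type)
         (omega theta : (X + W)%type -> (X + W)%type -> R),
    is_marked A r omega theta /\
    geometric A omega 12 /\
    expanding A r omega d 1 /\
    lipschitz A r omega d (C * ln (#|X|%:R)) /\
    depth0 A r + depthI A r theta <= C * ln (#|X|%:R).
Proof.
exists 1728%:R; split => // X d dm X2.
have [W [A [r [omega [theta [mk geo ex lip dep]]]]]] := frt_marked_dag dm X2.
(* The literal 12 of the statement is [IZR 12], not a ring numeral. *)
have E12 : IZR 12 = 12%:R by rewrite (IZRposE 12) INRE.
exists W, A, r, omega, theta; rewrite E12.
by split; [|split; [|split; [exact: ex|]]].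
Qed.
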